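(* The number of eigenvalues of $\Delta^{\mathsf{Dir}}_{\Omega_\theta}$ less than $1$ (counted with multiplicity) tends to infinity at least like $\theta^{-1}$ as $\theta\to0$: there exist constants $c>0$ and $\theta_0\in(0,\frac{\pi}{2})$ such that, for all $\theta\in(0,\theta_0)$, this number is at least $c\,\theta^{-1}$.
   Context: For $\theta\in(0,\frac{\pi}{2})$ the broken guide is $$\Omega_\theta=\Big\{(x_1,x_2)\in\mathbb{R}^2:\ x_1\tan\theta<|x_2|<\Big(x_1+\frac{\pi}{\sin\theta}\Big)\tan\theta\Big\}.$$ $\Delta^{\mathsf{Dir}}_{\Omega_\theta}$ denotes the positive Dirichlet Laplacian on $\Omega_\theta$: the self-adjoint operator $\psi\mapsto-\Delta\psi$ on $L^2(\Omega_\theta)$ with domain $\{\psi\in H^1_0(\Omega_\theta):\ \Delta\psi\in L^2(\Omega_\theta)\}$. *)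

(* Defs.v *)
From HB Require Import structures.
From mathcomp Require Import all_boot all_order all_algebra.
From mathcomp Require Import all_classical all_reals all_analysis.
Set Implicit Arguments.
Unset Strict Implicit.
Unset Printing Implicit Defensive.
Import Order.TTheory GRing.Theory Num.Theory.
Import numFieldNormedType.Exports.
Local Open Scope classical_set_scope.
Local Open Scope ring_scope.

Section Guide.
Context {R : realType}.

Local Notation plane := (R * R)%type.

Definition broken_guide (theta : R) : set plane :=
  [set x | x.1 * tan theta < `|x.2| < (x.1 + pi / sin theta) * tan theta].

Local Notation area :=
  (@lebesgue_measure R \x @lebesgue_measure R)%E.

(** The Hilbert space L^2(Omega) is real. Its elements are represented by
    functions on the whole plane, of which only the restriction to Omega
    matters; [u \_ Omega] is the extension of that restriction by zero. *)
Definition L2 (Omega : set plane) (u : plane -> R) : Prop :=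
  u \_ Omega \in Lfun area 2%:E.

Definition d1 (f : plane -> R) : plane -> R := 'D_(1, 0) f.
Definition d2 (f : plane -> R) : plane -> R := 'D_(0, 1) f.

Definition laplacian (f : plane -> R) : plane -> R :=
  fun x => d1 (d1 f) x + d2 (d2 f) x.

(** C^k: all partial derivatives of order at most k exist and are
    continuous. *)
Fixpoint Ck (k : nat) (f : plane -> R) : Prop :=
  continuous f /\
  if k is k'.+1 then
    [/\ forall x, derivable f x (1, 0), forall x, derivable f x (0, 1),
        Ck k' (d1 f) & Ck k' (d2 f)]
  else True.

Definition smooth (f : plane -> R) : Prop := forall k, Ck k f.

Definition fsupport (f : plane -> R) : set plane :=
  closure [set x | f x != 0].

(** The space C_c^oo(Omega). *)
Definition test_function (Omega : set plane) (phi : plane -> R) : Prop :=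
  [/\ smooth phi, compact (fsupport phi) & fsupport phi `<=` Omega].

(** [g1] and [g2] are the first partial derivatives of [u] on Omega in the
    sense of distributions. *)
Definition weak_gradient (Omega : set plane) (u g1 g2 : plane -> R) : Prop :=
  forall phi, test_function Omega phi ->
    (\int[area]_(x in Omega) (u x * d1 phi x) =
      - (\int[area]_(x in Omega) (g1 x * phi x))) /\
    (\int[area]_(x in Omega) (u x * d2 phi x) =
      - (\int[area]_(x in Omega) (g2 x * phi x))).

(** H^1_0(Omega): the closure of C_c^oo(Omega) in H^1(Omega). *)
Definition H10 (Omega : set plane) (u : plane -> R) : Prop :=
  exists g1 g2 : plane -> R,
    [/\ L2 Omega u, L2 Omega g1, L2 Omega g2, weak_gradient Omega u g1 g2 &
      forall eps : R, 0 < eps -> exists2 phi, test_function Omega phi &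
        (\int[area]_(x in Omega)
           ((u x - phi x) ^+ 2 + (g1 x - d1 phi x) ^+ 2
             + (g2 x - d2 phi x) ^+ 2)%:E < eps%:E)%E].

(** Graph of the Dirichlet Laplacian: [psi] is in H^1_0(Omega), [f] is in
    L^2(Omega), and [- laplacian psi = f] in the sense of distributions
    on Omega. *)
Definition dirichlet_laplacian (Omega : set plane) (psi f : plane -> R)
    : Prop :=
  [/\ H10 Omega psi, L2 Omega f &
    forall phi, test_function Omega phi ->
      - (\int[area]_(x in Omega) (psi x * laplacian phi x)) =
        \int[area]_(x in Omega) (f x * phi x)].

(** Linear independence in L^2(Omega), that is, up to equality almost
    everywhere on Omega. *)
Definition lin_indep (Omega : set plane) (n : nat)
    (psi : 'I_n -> plane -> R) : Prop :=
  forall a : 'I_n -> R,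
    {ae area, forall x, Omega x -> \sum_(i < n) a i * psi i x = 0} ->
    forall i, a i = 0.

(** Dimension in [0, +oo] of the eigenspace ker (A - lambda), where A is an
    operator in L^2(Omega) given by its graph. It is 0 when lambda is not an
    eigenvalue. *)
Definition multiplicity (Omega : set plane)
    (A : (plane -> R) -> (plane -> R) -> Prop) (lambda : R) : \bar R :=
  ereal_sup [set n%:R%:E | n in [set n : nat |
    exists psi : 'I_n -> plane -> R,
      (forall i, A (psi i) (fun x => lambda * psi i x)) /\
      lin_indep Omega psi]].

(** Number of eigenvalues of A less than b, counted with multiplicity. *)
Definition eigenvalue_count (Omega : set plane)
    (A : (plane -> R) -> (plane -> R) -> Prop) (b : R) : \bar R :=
  \esum_(lambda in [set l : R | l < b]) multiplicity Omega A lambda.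

End Guide.

(* Main.v *)
Require Import Defs.
From mathcomp Require Import all_boot all_order all_algebra.
From mathcomp Require Import all_classical all_reals all_analysis.
From mathcomp Require Import measurable_realfun.
From mathcomp Require Import ring lra zify.
Set Implicit Arguments.
Unset Strict Implicit.
Unset Printing Implicit Defensive.
Import Order.TTheory GRing.Theory Num.Theory.
Import numFieldNormedType.Exports.
Local Open Scope classical_set_scope.
Local Open Scope ring_scope.

(** Let [H] be the closure of the test functions in the norm given by the
    function and its gradient ([form_space]). On [H], [mass] is the square of
    the L^2 norm and [energy] is the Dirichlet integral, as bilinear forms. An
    element [psi] of [H] with [energy psi w = lam * mass psi w] for every [w] in
    [H] is an eigenfunction of the Dirichlet Laplacian ([form_space_eigen]),
    so it is enough to produce [n] such elements, orthonormal for [mass], with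
    [lam < 1] and [n] of order [1 / theta] ([eigenvalue_count_ge]).

    They are found by minimizing [energy] on the unit sphere of [mass],
    successively on the orthogonal complement of those already found
    ([weak_eigenvectors]). Since the guide is unbounded, minimizing sequences
    need not converge in general. They do below the threshold [1 / kappa] as
    soon as there is a bound

      [mass u u <= kappa * energy u u + C * \sum_k ell_k u ^+ 2]

    with finitely many bounded linear functionals [ell_k]: along a subsequence
    all [ell_k] converge, and then the parallelogram law makes a minimizing
    sequence Cauchy ([minimizer_exists]). Every infimum stays at most [lam0] if
    [n] elements of [H], orthogonal for both forms, have Rayleigh quotient at
    most [lam0], because a combination of them is orthogonal to the fewer than
    [n] eigenvectors already found ([orthogonal_trial]). What remains is to
    obtain the bound and the trial elements with [lam0 * kappa < 1] and
    [lam0 < 1].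

    The bound ([coercive_form_space]). For [x1 > 0] a vertical slice of the
    guide consists of two intervals of length [L = pi / cos theta], and a
    function that vanishes at the ends of an interval of length [L] has its
    squared norm bounded by [L ^+ 2 / 4] times that of its derivative
    ([slice_poincare]). The part of the guide with [x1 <= 0] is bounded, hence
    covered by finitely many squares of side [1 / 2]; on each of them the
    Poincare-Wirtinger inequality bounds the mass by the energy with a smaller
    constant, up to the square of the integral ([cell_poincare]). These
    integrals are the functionals, and [kappa = L ^+ 2 / 4], so that [1 / kappa]
    is close to [4 / pi ^+ 2] when [theta] is small.

    The trial elements ([many_trials]). For [x1 < 0] the guide is the region
    [`|x2| < pi / cos theta + x1 * tan theta] around the first axis, whose
    height decreases slowly from [2 * pi / cos theta] as [x1] decreases from
    [0]. It contains about [1 / (1000 * theta)] non-overlapping rectangles with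
    half-sides [10 * pi] and [9 / 10 * pi]. On each of them a product of two
    smooth bumps has Rayleigh quotient at most
    [3 / (10 * pi) ^+ 2 + 3 / (9 / 10 * pi) ^+ 2], less than
    [374 / 100 / pi ^+ 2] ([trial_rayleigh]). This is below both [1] and
    [1 / kappa]. *)

(** * Symmetric bilinear forms on a subspace *)
Section Forms.
Context {R : realType} {V : lmodType R}.
Implicit Types (H K : set V) (f : V -> V -> R).

Definition subspace H :=
  H 0 /\ forall a u v, H u -> H v -> H (a *: u + v).

(** Symmetry is required everywhere and linearity only on [H]: the integral of
    a product is symmetric, but it is linear only where products are
    integrable. *)
Definition form_on H f :=
  (forall u v, f u v = f v u) /\
  (forall a u v w, H u -> H v -> H w -> f (a *: u + v) w = a * f u w + f v w).

Lemma subspaceZ H a u : subspace H -> H u -> H (a *: u).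
Proof. by move=> [H0 Hl] Hu; rewrite -[_ *: _]addr0; exact: Hl. Qed.

Lemma subspaceD H u v : subspace H -> H u -> H v -> H (u + v).
Proof. by move=> [H0 Hl] Hu Hv; rewrite -[u]scale1r; exact: Hl. Qed.

Lemma subspaceB H u v : subspace H -> H u -> H v -> H (u - v).
Proof. by move=> [H0 Hl] Hu Hv; rewrite addrC -scaleN1r; exact: Hl. Qed.

Lemma subspace_sum H n (a : 'I_n -> R) (w : 'I_n -> V) :
  subspace H -> (forall i, H (w i)) -> H (\sum_i a i *: w i).
Proof.
move=> sH Hw; apply: (big_ind H); [exact: sH.1|by move=> *; exact: subspaceD|].
by move=> i _; exact: subspaceZ.
Qed.

Section One.
Variables (H : set V) (f : V -> V -> R).
Hypotheses (sH : subspace H) (fH : form_on H f).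

Lemma formDl u v w : H u -> H v -> H w -> f (u + v) w = f u w + f v w.
Proof. by move=> *; rewrite -[u in LHS]scale1r fH.2// mul1r. Qed.

Lemma form0l w : H w -> f 0 w = 0.
Proof.
move=> Hw; have H0 := sH.1.
by have := formDl H0 H0 Hw; rewrite addr0 => /eqP; rewrite -subr_eq0 opprD addrA subrr sub0r oppr_eq0 => /eqP.
Qed.

Lemma formZl a u w : H u -> H w -> f (a *: u) w = a * f u w.
Proof.
by move=> Hu Hw; rewrite -[a *: u]addr0 fH.2// ?form0l ?addr0//; exact: sH.1.
Qed.

Lemma formBl u v w : H u -> H v -> H w -> f (u - v) w = f u w - f v w.
Proof. by move=> *; rewrite addrC -scaleN1r fH.2//; ring. Qed.

Lemma form_suml n (a : 'I_n -> R) (w : 'I_n -> V) u :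
  (forall i, H (w i)) -> H u -> f (\sum_i a i *: w i) u = \sum_i a i * f (w i) u.
Proof.
move=> Hw Hu; elim: n a w Hw => [|n IH] a w Hw; first by rewrite !big_ord0 form0l.
rewrite !big_ord_recl formDl ?formZl ?IH//; first exact: subspaceZ.
exact: subspace_sum.
Qed.

Lemma form_expand t u v : H u -> H v ->
  f (t *: v + u) (t *: v + u) = f u u + 2 * t * f u v + t ^+ 2 * f v v.
Proof.
move=> Hu Hv; have Hw : H (t *: v + u) by exact: sH.2.
rewrite fH.2// [f v _]fH.1 [f u (t *: _ + _)]fH.1 !fH.2// [f v u]fH.1; ring.
Qed.

Lemma form_parallelogram u v : H u -> H v ->
  f (u - v) (u - v) = 2 * f u u + 2 * f v v - f (u + v) (u + v).
Proof.
move=> Hu Hv; rewrite [u + v]addrC -[v in v + u]scale1r [u - v]addrC -scaleN1r.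
by rewrite !form_expand//; ring.
Qed.

Lemma form_CS u v : (forall w, H w -> 0 <= f w w) -> H u -> H v ->
  f u v ^+ 2 <= f u u * f v v.
Proof.
move=> f0 Hu Hv.
have P t : 0 <= f u u + 2 * t * f u v + t ^+ 2 * f v v.
  by rewrite -form_expand//; apply/f0/sH.2.
have [v0|v0] := eqVneq (f v v) 0.
  rewrite v0 mulr0; have [->|uv0] := eqVneq (f u v) 0; first by rewrite expr0n.
  (* [P] is affine in [t]; this is the value of [t] at which it equals [-1]. *)
  have := P (- (f u u + 1) / (2 * f u v)); rewrite v0 mulr0 addr0.
  have -> : f u u + 2 * (- (f u u + 1) / (2 * f u v)) * f u v = -1 by field.
  by move=> h; exfalso; move: h; apply/negP; rewrite -ltNge ltrN10.
have vp : 0 < f v v by rewrite lt_def v0 f0.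
have := P (- f u v / f v v).
have -> : f u u + 2 * (- f u v / f v v) * f u v + (- f u v / f v v) ^+ 2 * f v v
   = (f u u * f v v - f u v ^+ 2) / f v v by field.
by rewrite pmulr_lge0 ?invr_gt0// subr_ge0.
Qed.

End One.

Lemma form_on_sub H K f : K `<=` H -> form_on H f -> form_on K f.
Proof. by move=> KH [fs fl]; split=> // *; apply: fl; exact: KH. Qed.

Lemma form_on_shift H f g c : form_on H f -> form_on H g ->
  form_on H (fun u v => f u v - c * g u v).
Proof.
move=> [fs fl] [gs gl]; split=> [u v|a u v w Hu Hv Hw]; first by rewrite fs gs.
by rewrite fl// gl//; ring.
Qed.

End Forms.

Lemma increasing_seq_ge (s : nat -> nat) : increasing_seq s -> forall n, (n <= s n)%N.
Proof.
move=> si; elim=> // n IH; apply: leq_ltn_trans IH _.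
by have := si n.+1 n; rewrite ltnn leEnat ltnNge => ->.
Qed.

(** * Minimizing sequences *)
Lemma bolzano_weierstrass_seq {R : realType} {I : eqType} (s : seq I)
    (x : I -> nat -> R) (C : R) :
  (forall i n, `|x i n| <= C) ->
  exists2 f : nat -> nat, increasing_seq f &
    forall i, i \in s -> cvgn (x i \o f).
Proof.
move=> xC; elim: s => [|i s [f fi fs]]; first by exists id.
have [|g gi gc] := @bolzano_weierstrass R (x i \o f).
  exists C; split; first exact: num_real.
  by move=> y Cy n _; apply: le_trans (xC _ _) (ltW Cy).
exists (f \o g) => [m n|j]; first by rewrite /= fi; exact: gi.
rewrite inE => /orP[/eqP -> //|/fs /cvg_ex[l fl]].
apply/cvg_ex; exists l; rewrite compA; apply: (@cvg_comp _ _ _ g (x j \o f) _ \oo) => //.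
move=> A [N _ NA]; exists N => // n /= Nn; apply: NA => /=.
exact: leq_trans Nn (increasing_seq_ge gi _).
Qed.

Lemma cvg_sqr0 {R : realType} (x : nat -> R) :
  (fun n => x n ^+ 2) @ \oo --> 0 -> x @ \oo --> 0.
Proof.
move=> x2; apply/norm_cvg0P.
under eq_fun do rewrite -sqrtr_sqr.
by rewrite -(sqrtr0 R); apply: continuous_cvg x2; exact: sqrt_continuous.
Qed.

Section Minimizer.
Context {R : realType} {V : lmodType R}.

(** By Cauchy-Schwarz, [(f (u n) v - f l v) ^+ 2] is at most
    [f (u n - l) (u n - l) * f v v]. *)
Lemma form_cvgl (H : set V) f (u : nat -> V) l v : subspace H -> form_on H f ->
  (forall w, H w -> 0 <= f w w) -> (forall n, H (u n)) -> H l -> H v ->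
  (fun n => f (u n - l) (u n - l)) @ \oo --> 0 ->
  (fun n => f (u n) v) @ \oo --> f l v.
Proof.
move=> sH fH f0 Hu Hl Hv ul.
have Hw n : H (u n - l) by exact: subspaceB.
suff /cvg_sqr0 h : (fun n => (f (u n) v - f l v) ^+ 2) @ \oo --> 0.
  exact/(subr_cvg0 (F := \oo)).
apply: (@squeeze_cvgr _ _ _ _ (cst 0) (fun n => f (u n - l) (u n - l) * f v v)).
- near=> n; rewrite /= sqr_ge0 -(formBl fH)//=; exact: (form_CS sH fH f0).
- exact: cvg_cst.
- by rewrite -(mul0r (f v v)); apply: cvgMr_tmp.
Unshelve. all: end_near. Qed.

Lemma form_cvg (H : set V) f (u : nat -> V) l : subspace H -> form_on H f ->
  (forall w, H w -> 0 <= f w w) -> (forall n, H (u n)) -> H l ->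
  (fun n => f (u n - l) (u n - l)) @ \oo --> 0 ->
  (fun n => f (u n) (u n)) @ \oo --> f l l.
Proof.
move=> sH fH f0 Hu Hl ul.
have e n : f (u n) (u n) = f (u n - l) (u n - l) + 2 * f (u n) l - f l l.
  have -> : u n - l = -1 *: l + u n by rewrite addrC scaleN1r.
  by rewrite (form_expand sH fH)//; ring.
under eq_fun do rewrite e.
suff: (fun n => f (u n - l) (u n - l) + 2 * f (u n) l - f l l) @ \oo --> (0 + 2 * f l l - f l l).
  by rewrite (_ : 0 + 2 * f l l - f l l = f l l); last by ring.
apply: cvgB; last exact: cvg_cst.
apply: cvgD => //; apply: cvgMl_tmp; exact: (form_cvgl sH fH f0).
Qed.

Variables (H : set V) (b q : V -> V -> R).
Hypotheses (sH : subspace H) (bH : form_on H b) (qH : form_on H q).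
Hypothesis b0 : forall w, H w -> 0 <= b w w.
Hypothesis q0 : forall w, H w -> 0 <= q w w.
Hypothesis complete : forall u : nat -> V, (forall n, H (u n)) ->
  (forall e, 0 < e -> exists N, forall m n, (N <= m)%N -> (N <= n)%N ->
     b (u m - u n) (u m - u n) + q (u m - u n) (u m - u n) < e) ->
  exists l, [/\ H l, (fun n => b (u n - l) (u n - l)) @ \oo --> 0 &
    (fun n => q (u n - l) (u n - l)) @ \oo --> 0].
Variables (I : finType) (ell : I -> V -> R) (kappa C D : R).
Hypothesis ellB : forall i u v, H u -> H v -> ell i (u - v) = ell i u - ell i v.
Hypothesis ell_bounded : forall i u, H u -> ell i u ^+ 2 <= D * b u u.
Hypotheses (kappa0 : 0 < kappa) (C0 : 0 <= C).
Hypothesis coercive : forall u, H u ->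
  b u u <= kappa * q u u + C * \sum_i ell i u ^+ 2.

(** The form [r = q - lam * b] is nonnegative on [K] and tends to [0] along the
    minimizing sequence, so the parallelogram law makes [r] small on its
    differences. Coercivity turns this into smallness of [b] on the
    differences: as [lam * kappa < 1], the term [kappa * lam * b] that it
    produces is absorbed, and the functionals are Cauchy along a subsequence.
    Smallness of [b] and [r] gives that of [q]. *)
Lemma minimizer_exists (K : set V) (lam : R) : subspace K -> K `<=` H ->
  (forall u l, (forall n, K (u n)) -> H l ->
    (fun n => b (u n - l) (u n - l)) @ \oo --> 0 -> K l) ->
  lam * kappa < 1 -> (forall u, K u -> lam * b u u <= q u u) ->
  (forall e, 0 < e -> exists u, [/\ K u, b u u = 1 & q u u < lam + e]) ->
  exists psi, [/\ K psi, b psi psi = 1 & q psi psi = lam].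
Proof.
move=> sK KH clK lk lb inf.
have /choice[u hu] n : exists u, [/\ K u, b u u = 1 & q u u < lam + n.+1%:R^-1].
  by apply: inf; rewrite invr_gt0.
have Ku n : K (u n) by case: (hu n).
have Hu n : H (u n) by exact: KH.
have bu n : b (u n) (u n) = 1 by case: (hu n).
have qu n : q (u n) (u n) < lam + n.+1%:R^-1 by case: (hu n).
have D0 i n : `|ell i (u n)| <= Num.sqrt D.
  by rewrite -sqrtr_sqr ler_wsqrtr// (le_trans (ell_bounded _ (Hu n)))// bu mulr1.
have [s si sc] := bolzano_weierstrass_seq (enum I) D0.
have sge := increasing_seq_ge si.
have {}sc i : cvgn (ell i \o (u \o s)) by apply: sc; rewrite mem_enum.
pose v := u \o s; pose r w := q w w - lam * b w w.
have Kv n : K (v n) by exact: Ku.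
have Hv n : H (v n) by exact: Hu.
have bv n : b (v n) (v n) = 1 by exact: bu.
have rv n : r (v n) < n.+1%:R^-1.
  rewrite /r bv mulr1 ltrBlDl; apply: (lt_le_trans (qu _)).
  by rewrite lerD2l lef_pV2 ?posrE// ler_nat ltnS sge.
have rH := form_on_shift lam qH bH.
have r0 w : K w -> 0 <= r w by move=> Kw; rewrite subr_ge0 lb.
have rB m n : r (v m - v n) <= 2 * m.+1%:R^-1 + 2 * n.+1%:R^-1.
  rewrite /r (form_parallelogram sH rH)//.
  have := r0 _ (subspaceD sK (Kv m) (Kv n)); have := rv m; have := rv n.
  by rewrite /r; move: (n.+1%:R^-1) (m.+1%:R^-1) => x y; lra.
pose S m n := \sum_i ell i (v m - v n) ^+ 2.
have S0 m n : 0 <= S m n by apply: sumr_ge0 => i _; exact: sqr_ge0.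
have bB m n : (1 - lam * kappa) * b (v m - v n) (v m - v n) <=
    kappa * (2 * m.+1%:R^-1 + 2 * n.+1%:R^-1) + C * S m n.
  have Hmn := subspaceB sH (Hv m) (Hv n).
  have := coercive Hmn; have := rB m n; rewrite -/(S m n).
  move/(ler_wpM2l (ltW kappa0)); rewrite /r; move: (n.+1%:R^-1) (m.+1%:R^-1) => x y; lra.
have Scauchy e : 0 < e -> exists N, forall m n, (N <= m)%N -> (N <= n)%N -> S m n < e.
  move=> e0; pose d := Num.sqrt (e / #|I|.+1%:R).
  have d0 : 0 < d by rewrite sqrtr_gt0 divr_gt0.
  have /choice[N hN] i : exists N, forall m n, (N <= m)%N -> (N <= n)%N ->
      `|ell i (v m) - ell i (v n)| < d.
    have /cauchy_cvgP/cauchy_ballP/(_ _ d0) := sc i.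
    case=> -[A B] [[N1 _ h1] [N2 _ h2]] AB; exists (maxn N1 N2) => m n.
    rewrite !geq_max => /andP[a1 a2] /andP[b1 b2].
    by apply: (AB (ell i (v m), ell i (v n))); split; [exact: h1|exact: h2].
  exists (\max_i N i)%N => m n Nm Nn.
  apply: (@le_lt_trans _ _ (\sum_(i : I) e / #|I|.+1%:R)).
    apply: ler_sum => i _; rewrite ellB//.
    have h : `|ell i (v m) - ell i (v n)| < d.
      by apply: hN; [apply: leq_trans Nm|apply: leq_trans Nn]; exact: leq_bigmax.
    rewrite -real_normK ?num_real// -[e / _]sqr_sqrtr ?divr_ge0 ?(ltW e0)//.
    by rewrite ler_pXn2r ?nnegrE ?sqrtr_ge0 ?normr_ge0// ltW.
  rewrite sumr_const -[(e / _) *+ _]mulr_natr -mulrA gtr_pMr// mulrC ltr_pdivrMr//.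
  by rewrite mul1r ltr_nat.
have tend e : 0 < e -> exists N, forall n, (N <= n)%N -> n.+1%:R^-1 < e :> R.
  move=> e0; have [N _ hN] := near_infty_natSinv_lt (PosNum e0).
  by exists N => n Nn; exact: hN.
have cauchy e : 0 < e -> exists N, forall m n, (N <= m)%N -> (N <= n)%N ->
    b (v m - v n) (v m - v n) + q (v m - v n) (v m - v n) < e.
  move=> e0; have k0 : 0 < 1 - lam * kappa by rewrite subr_gt0.
  (* [e2] carries the factor [1 - lam * kappa] that is divided out in [bB] and
     makes up for the [`|lam|] by which [b] enters the bound on [q]. *)
  pose L := 1 + `|lam|; have L0 : 0 < L by rewrite ltr_pwDl.
  pose e1 := e / 16; have e10 : 0 < e1 by rewrite divr_gt0.
  pose e2 := e / 16 * (1 - lam * kappa) / L.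
  have e20 : 0 < e2 by rewrite divr_gt0// mulr_gt0.
  have [N1 h1] := tend _ e10.
  have [N2 h2] := tend (e2 / kappa) (divr_gt0 e20 kappa0).
  have [N3 h3] := Scauchy (e2 / (C + 1)) (divr_gt0 e20 (ltr_wpDl C0 ltr01)).
  exists (maxn N1 (maxn N2 N3)) => m n.
  rewrite !geq_max => /and3P[m1 m2 m3] /and3P[n1 n2 n3].
  have hb : b (v m - v n) (v m - v n) * L <= 5 * (e / 16).
    have a1 : kappa * (2 * m.+1%:R^-1 + 2 * n.+1%:R^-1) <= 4 * e2.
      have := h2 _ m2; have := h2 _ n2; rewrite !(ltr_pdivlMr _ _ kappa0).
      by move: (n.+1%:R^-1) (m.+1%:R^-1) => x y; lra.
    have a2 : C * S m n <= e2.
      have := h3 _ _ m3 n3; rewrite ltr_pdivlMr ?ltr_wpDl// => /ltW; apply: le_trans.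
      by rewrite mulrC ler_wpM2l//  lerDl ler01.
    have a3 : (1 - lam * kappa) * b (v m - v n) (v m - v n) <= 5 * e2.
      have := bB m n; move: a1 a2.
      by move: (n.+1%:R^-1) (m.+1%:R^-1) => x y; lra.
    have e2L : e2 * L = e / 16 * (1 - lam * kappa) by rewrite /e2 mulfVK ?gt_eqF.
    have := ler_wpM2r (ltW L0) a3 => h; rewrite -(ler_pM2l k0).
    by move: h e2L; clearbody e2 L; lra.
  have hq : q (v m - v n) (v m - v n) <= 4 * (e / 16) + `|lam| * b (v m - v n) (v m - v n).
    have := rB m n; have := h1 _ m1; have := h1 _ n1; rewrite /r /e1.
    have : lam * b (v m - v n) (v m - v n) <= `|lam| * b (v m - v n) (v m - v n).
      by rewrite ler_wpM2r ?ler_norm// b0//; exact: subspaceB.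
    by move: (n.+1%:R^-1) (m.+1%:R^-1) => x y; lra.
  by move: hb hq; rewrite /L; lra.
have [psi [Hpsi bpsi qpsi]] := complete Hv cauchy.
have b1 : b psi psi = 1.
  have := form_cvg sH bH b0 Hv Hpsi bpsi.
  under eq_fun do rewrite bv.
  by move/(cvg_lim (@Rhausdorff R)) => <-; rewrite lim_cst.
exists psi; split=> //; first exact: clK bpsi.
have Kpsi : K psi by exact: clK bpsi.
apply/eqP; rewrite eq_le; apply/andP; split; last by have := lb _ Kpsi; rewrite b1 mulr1.
have qc := form_cvg sH qH q0 Hv Hpsi qpsi.
apply/ler_addgt0Pr => e e0; rewrite -(cvg_lim (@Rhausdorff R) qc).
apply: limr_le; first by apply/cvg_ex; exists (q psi psi).
have [N hN] := tend _ e0; exists N => // n /= Nn.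
by have := rv n; have := hN _ Nn; rewrite /r bv; move: (n.+1%:R^-1) => x; lra.
Qed.
End Minimizer.

(** * Weak eigenvectors below the threshold *)
Section WeakEigenvectors.
Context {R : realType} {V : lmodType R}.
Variables (H : set V) (b q : V -> V -> R).
Hypotheses (sH : subspace H) (bH : form_on H b) (qH : form_on H q).
Hypothesis b0 : forall w, H w -> 0 <= b w w.
Hypothesis q0 : forall w, H w -> 0 <= q w w.
Hypothesis complete : forall u : nat -> V, (forall n, H (u n)) ->
  (forall e, 0 < e -> exists N, forall m n, (N <= m)%N -> (N <= n)%N ->
     b (u m - u n) (u m - u n) + q (u m - u n) (u m - u n) < e) ->
  exists l, [/\ H l, (fun n => b (u n - l) (u n - l)) @ \oo --> 0 &
    (fun n => q (u n - l) (u n - l)) @ \oo --> 0].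
Variables (I : finType) (ell : I -> V -> R) (kappa C D : R).
Hypothesis ellB : forall i u v, H u -> H v -> ell i (u - v) = ell i u - ell i v.
Hypothesis ell_bounded : forall i u, H u -> ell i u ^+ 2 <= D * b u u.
Hypotheses (kappa0 : 0 < kappa) (C0 : 0 <= C).
Hypothesis coercive : forall u, H u ->
  b u u <= kappa * q u u + C * \sum_i ell i u ^+ 2.

(** Orthogonality to [k] vectors is a system of [k] linear equations in the
    [n > k] coefficients of a combination of the [v i], so it has a nonzero
    solution. Since the [v i] are orthogonal for both forms, the Rayleigh
    quotient of a combination is an average of theirs. *)
Lemma orthogonal_trial n (v : 'I_n -> V) (lam0 : R) k (psi : nat -> V) :
  (forall i, H (v i)) -> (forall i j, i != j -> b (v i) (v j) = 0) ->
  (forall i j, i != j -> q (v i) (v j) = 0) -> (forall i, 0 < b (v i) (v i)) ->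
  (forall i, q (v i) (v i) <= lam0 * b (v i) (v i)) ->
  (k < n)%N -> (forall i, (i < k)%N -> H (psi i)) ->
  exists w, [/\ H w, forall i, (i < k)%N -> b w (psi i) = 0, b w w = 1 &
    q w w <= lam0].
Proof.
move=> Hv bv qv bv0 qlam kn Hpsi.
pose A := \matrix_(i < n, j < k) b (v i) (psi j).
have : kermx A != 0.
  rewrite -mxrank_eq0 mxrank_ker subn_eq0 -ltnNge.
  exact: leq_ltn_trans (rank_leq_col A) kn.
case/matrix0Pn => r [s rs].
pose x i := kermx A r i.
have xA j : \sum_i x i * b (v i) (psi j) = 0 \/ (k <= j)%N.
  have [kj|jk] := leqP k j; [by right|left].
  have /matrixP/(_ r (Ordinal jk)) := mulmx_ker A.
  by rewrite !mxE => h; rewrite -[RHS]h; apply: eq_bigr => i _; rewrite [A i _]mxE.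
pose w := \sum_i x i *: v i.
have Hw : H w by exact: subspace_sum.
have diag f : form_on H f -> (forall i j, i != j -> f (v i) (v j) = 0) ->
    f w w = \sum_i x i ^+ 2 * f (v i) (v i).
  move=> fH fv; rewrite [LHS](form_suml sH fH)//; apply: eq_bigr => i _.
  rewrite fH.1 (form_suml sH fH)// (bigD1 i)//= big1 ?addr0 => [|j ji].
    by rewrite mulrA expr2.
  by rewrite fv// mulr0.
have bw : 0 < b w w.
  rewrite (diag _ bH bv) (bigD1 s)//= ltr_pwDl//.
    by rewrite mulr_gt0// exprn_even_gt0.
  by apply: sumr_ge0 => i _; rewrite mulr_ge0 ?sqr_ge0 ?ltW.
have qw : q w w <= lam0 * b w w.
  rewrite (diag _ bH bv) (diag _ qH qv) mulr_sumr; apply: ler_sum => i _.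
  by rewrite mulrCA ler_wpM2l// sqr_ge0.
pose c := (Num.sqrt (b w w))^-1.
have c2 : c ^+ 2 = (b w w)^-1 by rewrite exprVn sqr_sqrtr// ltW.
have scale f : form_on H f -> f (c *: w) (c *: w) = c ^+ 2 * f w w.
  move=> fH; have Hc : H (c *: w) by exact: subspaceZ.
  by rewrite (formZl sH fH)// fH.1 (formZl sH fH)// mulrA expr2.
exists (c *: w); split; first exact: subspaceZ.
- move=> i ik; rewrite (formZl sH bH)//; last exact: Hpsi.
  rewrite (form_suml sH bH)//; last exact: Hpsi.
  by case: (xA i) => [->|]; rewrite ?mulr0// leqNgt ik.
- by rewrite (scale _ bH) c2 mulVf// gt_eqF.
- by rewrite (scale _ qH) c2 mulrC ler_pdivrMr.
Qed.

(** Induction on the number of eigenvectors. If [phi] minimizes [q] on the unit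
    sphere of the orthogonal complement [K] of the previous ones, with minimum
    [mu], then [q - mu * b] is nonnegative on [K] and vanishes at [phi], hence
    by Cauchy-Schwarz [q phi u = mu * b phi u] for [u] in [K]. Against a
    previous eigenvector both sides vanish, so the equation holds on [H]. *)
Theorem weak_eigenvectors n (v : 'I_n -> V) (lam0 : R) :
  (forall i, H (v i)) -> (forall i j, i != j -> b (v i) (v j) = 0) ->
  (forall i j, i != j -> q (v i) (v j) = 0) -> (forall i, 0 < b (v i) (v i)) ->
  (forall i, q (v i) (v i) <= lam0 * b (v i) (v i)) -> lam0 * kappa < 1 ->
  exists (psi : nat -> V) (lam : nat -> R),
    (forall i, (i < n)%N -> [/\ H (psi i), lam i <= lam0 &
      forall w, H w -> q (psi i) w = lam i * b (psi i) w]) /\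
    (forall i j, (i < n)%N -> (j < n)%N -> b (psi i) (psi j) = (i == j)%:R).
Proof.
move=> Hv bv qv bv0 qlam lk.
suff /(_ n (leqnn n)) : forall k, (k <= n)%N ->
    exists (psi : nat -> V) (lam : nat -> R),
    (forall i, (i < k)%N -> [/\ H (psi i), lam i <= lam0 &
      forall w, H w -> q (psi i) w = lam i * b (psi i) w]) /\
    (forall i j, (i < k)%N -> (j < k)%N -> b (psi i) (psi j) = (i == j)%:R) by [].
elim=> [|k IH] kn; first by exists (fun=> 0), (fun=> 0).
have [psi [lam [eig orth]]] := IH (ltnW kn).
have Hpsi i : (i < k)%N -> H (psi i) by case/eig.
pose K := [set u | H u /\ forall i, (i < k)%N -> b u (psi i) = 0].
have KH : K `<=` H by move=> u [].
have sK : subspace K.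
  split=> [|a u w [Hu ub] [Hw wb]].
    by split=> [|i ik]; [exact: sH.1|rewrite (form0l sH bH)//; exact: Hpsi].
  split=> [|i ik]; first exact: sH.2.
  by rewrite bH.2// ?ub ?wb ?mulr0 ?addr0//; exact: Hpsi.
have clK u l : (forall n, K (u n)) -> H l ->
    (fun n => b (u n - l) (u n - l)) @ \oo --> 0 -> K l.
  move=> Ku Hl ul; split=> // i ik.
  have := form_cvgl sH bH b0 (fun n => KH _ (Ku n)) Hl (Hpsi _ ik) ul.
  under eq_fun do rewrite (Ku _).2//.
  by move/(cvg_lim (@Rhausdorff R)) => <-; rewrite lim_cst.
have [w [Hw wpsi bw qw]] := orthogonal_trial Hv bv qv bv0 qlam kn Hpsi.
pose S := [set q u u | u in [set u | K u /\ b u u = 1]].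
have Sw : S (q w w) by exists w.
have lS : has_inf S by split; [exists (q w w)|exists 0 => _ [u [Ku _] <-]; exact/q0/KH].
pose mu := inf S.
have mu0 : mu <= lam0 by apply: le_trans qw; apply: (ge_inf _ Sw); exact: lS.2.
have lb u : K u -> mu * b u u <= q u u.
  move=> Ku; have Hu := KH _ Ku; have [u0|u0] := eqVneq (b u u) 0.
    by rewrite u0 mulr0 q0.
  have bu : 0 < b u u by rewrite lt_def u0 b0.
  pose c := (Num.sqrt (b u u))^-1.
  have c2 : c ^+ 2 = (b u u)^-1 by rewrite exprVn sqr_sqrtr// ltW.
  have scale f : form_on H f -> f (c *: u) (c *: u) = c ^+ 2 * f u u.
    move=> fH; have Hc : H (c *: u) by exact: subspaceZ.
    by rewrite (formZl sH fH)// fH.1 (formZl sH fH)// mulrA expr2.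
  rewrite -ler_pdivlMr// mulrC -c2 -(scale _ qH); apply: (ge_inf lS.2).
  exists (c *: u) => //; split; first exact: subspaceZ.
  by rewrite (scale _ bH) c2 mulVf.
have inf e : 0 < e -> exists u, [/\ K u, b u u = 1 & q u u < mu + e].
  by move=> e0; have [_ [u [Ku bu] <-] h] := inf_adherent e0 lS; exists u.
have muk : mu * kappa < 1 by apply: le_lt_trans lk; rewrite ler_wpM2r// ltW.
have [phi [Kphi bphi qphi]] := minimizer_exists sH bH qH b0 q0 complete ellB
  ell_bounded kappa0 C0 coercive sK KH clK muk lb inf.
have Hphi := KH _ Kphi.
have rK := form_on_sub KH (form_on_shift mu qH bH).
have rphi u : K u -> q phi u = mu * b phi u.
  move=> Ku; have := @form_CS _ _ _ _ sK rK phi u.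
  rewrite qphi bphi mulr1 subrr mul0r => /(_ _ Kphi Ku) h.
  apply/eqP; rewrite -subr_eq0 -sqrf_eq0 eq_le sqr_ge0 andbT; apply: h.
  by move=> x Kx; rewrite subr_ge0 lb.
exists (fun i => if (i < k)%N then psi i else phi),
  (fun i => if (i < k)%N then lam i else mu); split=> [i|i j].
- rewrite ltnS leq_eqVlt => /orP[/eqP ->|ik]; last by rewrite ik; exact: eig.
  rewrite ltnn; split=> // u Hu.
  pose y := \sum_(j < k) b u (psi j) *: psi j.
  have Hy : H y by apply: subspace_sum => // j; exact: Hpsi.
  have Hpj (j : 'I_k) : H (psi j) by exact: Hpsi.
  have Kuy : K (u - y).
    split=> [|j jk]; first exact: subspaceB.
    rewrite (formBl bH)//; last exact: Hpsi.
    rewrite (form_suml sH bH)//; last exact: Hpsi.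
    rewrite (bigD1 (Ordinal jk))//= big1 ?addr0 => [|i0 i0j]; rewrite orth ?eqxx ?mulr1 ?subrr//.
    by rewrite -val_eqE/= in i0j; rewrite (negbTE i0j) mulr0.
  have fy f : form_on H f -> (forall j : 'I_k, f phi (psi j) = 0) -> f phi y = 0.
    move=> fH fj; rewrite fH.1 (form_suml sH fH)// big1// => j _.
    by rewrite fH.1 fj mulr0.
  have bj (j : 'I_k) : b phi (psi j) = 0 by exact: Kphi.2.
  have byp : b phi y = 0 by exact: fy.
  have qyp : q phi y = 0.
    apply: fy => // j; have [_ _ e] := eig _ (ltn_ord j); rewrite qH.1 e//.
    by rewrite bH.1 bj mulr0.
  have := rphi _ Kuy.
  rewrite qH.1 [b phi _]bH.1 (formBl qH)// (formBl bH)//.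
  by rewrite [q y phi]qH.1 [b y phi]bH.1 byp qyp !subr0 [q u _]qH.1 [b u _]bH.1.
- rewrite !ltnS [(i <= _)%N]leq_eqVlt [(j <= _)%N]leq_eqVlt.
  move=> /orP[/eqP ->|ik] /orP[/eqP ->|jk].
  + by rewrite !ltnn eqxx.
  + by rewrite ltnn jk Kphi.2// gtn_eqF.
  + by rewrite ltnn ik bH.1 Kphi.2// ltn_eqF.
  + by rewrite ik jk orth.
Qed.
End WeakEigenvectors.

(** * Square-integrable functions and completeness *)
Section SquareIntegrable.
Context d {T : measurableType d} {R : realType} (mu : {measure set T -> \bar R}).
Implicit Types f g h : T -> R.

Definition Lsq : set (T -> R) :=
  [set f : T -> R | measurable_fun setT f /\ (\int[mu]_x (f x ^+ 2)%:E < +oo)%E].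

Definition ip f g : R := \int[mu]_x (f x * g x).

Lemma LsqP f : Lsq f <-> f \in Lfun mu 2%:E.
Proof.
split=> [[mf foo]|fL].
  rewrite inE; apply/andP; split; rewrite inE//= /finite_norm unlock /=.
  apply: poweR_lty; rewrite (le_lt_trans _ foo)//; apply: ge0_le_integral => //.
  - apply/measurable_EFinP/(@measurableT_comp _ _ _ _ _ _ (fun x : R => x `^ 2)%R) => //.
    exact/measurableT_comp.
  - by apply/measurable_EFinP; exact: measurable_funX.
  - by move=> x _; rewrite lee_fin powR_mulrn ?normr_ge0// real_normK ?num_real.
have /integrableP[_ foo] := Lfun2_integrable_sqr fL.
move: fL; rewrite inE => /andP[/[!inE]/= mf _]; split=> //.
apply: le_lt_trans foo; apply: ge0_le_integral => //.
- by move=> x _; rewrite lee_fin sqr_ge0.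
- by apply/measurable_EFinP; exact: measurable_funX.
- by apply: measurableT_comp => //; apply/measurable_EFinP; exact: measurable_funX.
- by move=> x _ /=; rewrite lee_fin ler_norm.
Qed.

Lemma Lsq_subspace : subspace Lsq.
Proof.
have [z s] := Lfun_submod_closed mu (lee1n 2 : (1 <= 2%:E :> \bar R)%E).
by split=> [|a u v /LsqP uL /LsqP vL]; apply/LsqP; [exact: z|exact: s].
Qed.

Lemma LsqM_integrable f g : Lsq f -> Lsq g ->
  mu.-integrable setT (EFin \o (fun x => f x * g x)).
Proof.
by move=> /LsqP fL /LsqP gL; apply/Lfun1_integrable; exact: Lfun2_mul_Lfun1.
Qed.

Lemma ip_form : form_on Lsq ip.
Proof.
split=> [f g|a f g h fL gL hL]; first by apply: eq_Rintegral => x _; rewrite mulrC.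
rewrite /ip -RintegralZl//; last exact: LsqM_integrable.
rewrite -RintegralD//.
- by apply: eq_Rintegral => x _; rewrite mulrDl mulrA.
- have := LsqM_integrable (subspaceZ a Lsq_subspace fL) hL.
  by apply: eq_integrable => // x _ /=; rewrite mulrA.
- exact: LsqM_integrable.
Qed.

Lemma ip_ge0 f : 0 <= ip f f.
Proof. by apply: Rintegral_ge0 => x _; rewrite -expr2 sqr_ge0. Qed.

Lemma ip_EFin f : Lsq f -> (ip f f)%:E = (\int[mu]_x (f x ^+ 2)%:E)%E.
Proof.
move=> [mf foo]; rewrite /ip /Rintegral fineK.
  by apply: eq_integral => x _; rewrite expr2.
under eq_integral do rewrite -expr2.
by rewrite ge0_fin_numE//; apply: integral_ge0 => x _; rewrite lee_fin sqr_ge0.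
Qed.

Lemma ip_ae0 (D : set T) f g : Lsq f -> Lsq g -> (forall x, ~ D x -> f x = 0) ->
  {ae mu, forall x, D x -> g x = 0} -> ip f g = 0.
Proof.
move=> [mf _] [mg _] f0 g0.
rewrite /ip /Rintegral (_ : (\int[mu]_x (f x * g x)%:E)%E = 0%E)//.
transitivity (\int[mu]_x cst 0%E x)%E; last exact: integral0.
apply: ae_eq_integral => //; first exact/measurable_EFinP/measurable_funM.
apply: filterS g0 => x gx _ /=.
by have [/gx ->|/f0 ->] := pselect (D x); rewrite ?mulr0 ?mul0r.
Qed.

(** The increments are at most [sqrt M * 2^-k]. *)
Lemma cvg_dominated_telescope (u : nat -> R) (M : R) :
  (forall k, 4 ^+ k * (u k.+1 - u k) ^+ 2 <= M) -> cvgn u.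
Proof.
move=> uM; have M0 : 0 <= M.
  by apply: le_trans (uM 0%N); rewrite mulr_ge0 ?sqr_ge0.
have -> : u = (fun n => u 0%N + series (telescope u) n).
  by apply/funext => n; rewrite -eq_sum_telescope.
apply: is_cvgD; first exact: is_cvg_cst.
apply: normed_cvg; apply: (@series_le_cvg _ _ (geometric (Num.sqrt M) 2^-1)) => //.
- by move=> n /=; exact: normr_ge0.
- by move=> n; rewrite /geometric/= mulr_ge0 ?sqrtr_ge0// exprn_ge0// invr_ge0.
- move=> n; rewrite /geometric /telescope /=.
  rewrite exprVn ler_pdivlMr ?exprn_gt0// -[leLHS]ger0_norm ?mulr_ge0 ?exprn_ge0//.
  rewrite -sqrtr_sqr ler_wsqrtr// exprMn mulrC real_normK ?num_real//.
  by rewrite -exprM mulnC exprM -natrX.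
- apply: is_cvg_geometric_series.
  by rewrite ger0_norm ?invr_ge0// invf_lt1// ltr1n.
Qed.

Lemma limn_einf_le (u : (\bar R)^nat) (l : \bar R) N :
  (forall n, (N <= n)%N -> (u n <= l)%E) -> (limn_einf u <= l)%E.
Proof.
move=> ul; rewrite limn_einf_lim; apply: lime_le; first exact: is_cvg_einfs.
apply: nearW => n; rewrite /einfs /=.
apply: (@le_trans _ _ (u (maxn n N))); last by apply: ul; exact: leq_maxr.
by apply: ereal_inf_lbound; exists (maxn n N) => //=; exact: leq_maxl.
Qed.

(** Along a subsequence [g] with [ip (g k.+1 - g k) (g k.+1 - g k) < 8^-k] the
    sum of the [4^k * (g k.+1 - g k)^2] has finite integral, so it is finite
    almost everywhere and [g] converges almost everywhere. By Fatou's lemma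
    the pointwise limit is also the limit in the mean. *)
Theorem riesz_fischer (f : nat -> T -> R) : (forall n, Lsq (f n)) ->
  (forall e, 0 < e -> exists N, forall m n, (N <= m)%N -> (N <= n)%N ->
     ip (f m - f n) (f m - f n) < e) ->
  exists2 h, Lsq h & (fun n => ip (f n - h) (f n - h)) @ \oo --> 0.
Proof.
move=> fL fC; have Lf m n := subspaceB Lsq_subspace (fL m) (fL n).
have /choice[N hN] k : exists N, forall m n, (N <= m)%N -> (N <= n)%N ->
    ip (f m - f n) (f m - f n) < 8^-1 ^+ k.
  by apply: fC; rewrite exprn_gt0// invr_gt0.
(* The maximum makes [s] nondecreasing, the summand [k] makes it unbounded. *)
pose s k := (k + \max_(i < k.+1) N i)%N.
have sN k : (N k <= s k)%N by rewrite /s (leq_trans _ (leq_addl _ _))//; exact: (@leq_bigmax _ (fun i : 'I_k.+1 => N i) ord_max).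
have sS k : (s k <= s k.+1)%N by rewrite [s k.+1]/s big_ord_recr/= leq_add// leq_maxl.
pose g k := f (s k).
pose D k x := (4 ^+ k * (g k.+1 x - g k x) ^+ 2)%:E : \bar R.
have D0 k x : (0 <= D k x)%E by rewrite lee_fin mulr_ge0 ?sqr_ge0// exprn_ge0.
have mD k : measurable_fun setT (D k).
  apply/measurable_EFinP; apply: measurable_funM; first exact: measurable_cst.
  by apply: measurable_funX; apply: measurable_funB; exact: (fL _).1.
have intD k : (\int[mu]_x D k x <= (2^-1 ^+ k)%:E)%E.
  rewrite /D; under eq_integral do rewrite EFinM.
  rewrite ge0_integralZl_EFin// ?exprn_ge0//; last first.
  - apply/measurable_EFinP; exact: (measurable_funX 2 (Lf (s k.+1) (s k)).1).
  - by move=> x _; rewrite lee_fin sqr_ge0.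
  rewrite -[X in (_ * X)%E](ip_EFin (Lf (s k.+1) (s k))) -EFinM lee_fin.
  have := hN k _ _ (leq_trans (sN k) (sS k)) (sN k).
  move=> /ltW/(ler_wpM2l (exprn_ge0 k (ler0n R 4))) /le_trans; apply.
  rewrite -exprMn (_ : 4 * 8^-1 = 2^-1 :> R)//.
  by rewrite -[8]/((2 * 4)%N%:R) natrM invfM mulrCA divff ?mulr1.
have [mG Goo] : measurable_fun setT (fun x => \sum_(k <oo) D k x)%E /\
    (\int[mu]_x (\sum_(k <oo) D k x) < +oo)%E.
  split; first by apply: ge0_emeasurable_sum => // k x _ _; exact: D0.
  rewrite integral_nneseries//.
  apply: (@le_lt_trans _ _ (\sum_(k <oo) (2^-1 ^+ k)%:E)%E).
    by apply: lee_nneseries => [k _ _|k _]; [exact: integral_ge0|exact: intD].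
  rewrite (_ : (\sum_(k <oo) (2^-1 ^+ k)%:E)%E = 2%:E) ?ltry//.
  have half : `|2^-1 : R| < 1 by rewrite ger0_norm ?invr_ge0// invf_lt1// ltr1n.
  have := @cvg_geometric_series R 1 2^-1 half.
  rewrite (_ : 1 / (1 - 2^-1) = 2 :> R); last by field.
  move=> h; apply/cvg_lim => //.
  under eq_fun do rewrite sumEFin.
  apply: cvg_EFin; first by apply: nearW.
  apply: cvg_trans h; apply: near_eq_cvg; apply: nearW => n /=.
  by apply: eq_bigr => i _; rewrite /geometric/= mul1r.
have aeG : {ae mu, forall x, cvgn (g ^~ x)}.
  have iG : mu.-integrable setT (fun x => \sum_(k <oo) D k x)%E.
    apply/integrableP; split => //; apply: le_lt_trans Goo.
    under eq_integral => x _ do rewrite gee0_abs ?nneseries_ge0//.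
    exact: lexx.
  have := integrable_ae measurableT iG; apply: filterS => x /(_ Logic.I) Gx.
  apply: (@cvg_dominated_telescope _ (fine (\sum_(k <oo) D k x)%E)) => k.
  rewrite -lee_fin fineK// (@nneseries_split _ _ 0 k.+1)// add0n big_nat_recr//=.
  apply: (@le_trans _ _ (\sum_(0 <= i < k) D i x + D k x)%E).
    by rewrite leeDr//; apply: sume_ge0 => i _; exact: D0.
  by rewrite leeDl// nneseries_ge0.
(* An upper limit is measurable also where the sequence diverges. *)
pose h x := fine (limn_esup (fun k => (g k x)%:E)).
have mh : measurable_fun setT h.
  apply: (measurableT_comp (fine_measurable measurableT)).
  by apply: measurable_fun_limn_esup => n; apply/measurable_EFinP; exact: (fL _).1.
have hlim x : cvgn (g ^~ x) -> g ^~ x @ \oo --> h x.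
  move=> /cvg_ex[l gl]; rewrite (_ : h x = l)//.
  have /cvg_limn_einf_sup[_ e] : (fun k => (g k x)%:E) @ \oo --> l%:E.
    by apply: cvg_EFin gl; exact: nearW.
  by rewrite /h e.
have key e n : 0 < e -> (forall m, (n <= m)%N -> ip (f m - f n) (f m - f n) < e) ->
    (\int[mu]_x ((h x - f n x) ^+ 2)%:E <= e%:E)%E.
  move=> e0 fe.
  have mf k : measurable_fun setT (fun x => ((g k x - f n x) ^+ 2)%:E).
    by apply/measurable_EFinP/measurable_funX; exact: (Lf _ _).1.
  rewrite (@ge0_ae_eq_integral _ _ _ _ _ _
    (fun x => limn_einf (fun k => ((g k x - f n x) ^+ 2)%:E)))//.
  - apply: (le_trans (fatou _ measurableT mf _)).
      by move=> k x _; rewrite lee_fin sqr_ge0.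
    apply: (@limn_einf_le _ _ n) => k nk.
    rewrite -[leLHS](ip_EFin (Lf (s k) n)) lee_fin ltW// fe//.
    exact: leq_trans nk (leq_addr _ _).
  - by apply/measurable_EFinP/measurable_funX; apply: measurable_funB => //; exact: (fL _).1.
  - have := measurable_fun_limn_esup (fun k => measurableT_comp (@oppe_measurable R _) (mf k)).
    by move/(measurableT_comp (@oppe_measurable R _)).
  - by move=> x _; rewrite lee_fin sqr_ge0.
  - move=> x _; rewrite limn_einf_lim; apply: lime_ge; first exact: is_cvg_einfs.
    apply: nearW => k; apply: le_ereal_inf_tmp => _ [m /= _ <-].
    by rewrite lee_fin sqr_ge0.
  - apply: filterS aeG => x /hlim gx _.
    have gf : (fun k => ((g k x - f n x) ^+ 2)%:E) @ \oo --> ((h x - f n x) ^+ 2)%:E; last by rewrite (cvg_limn_einf_sup gf).1.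
      apply: cvg_EFin; first exact: nearW.
      by rewrite expr2; under eq_fun do rewrite expr2;
      apply: cvgM; apply: cvgB => //; exact: cvg_cst.
have hL : Lsq h.
  have [n fe] := fC 1 ltr01.
  have h1 := key 1 n ltr01 (fun m nm => fe m n nm (leqnn n)).
  have -> : h = (h - f n) + f n by apply/funext => x; rewrite /= subrK.
  apply: subspaceD Lsq_subspace _ (fL n); split.
    by apply: measurable_funB => //; exact: (fL n).1.
  exact: le_lt_trans h1 (ltry _).
exists h => //; apply/cvgrPdist_le => e e0.
have [n fe] := fC e e0; exists n => // m /= nm.
have Lhm := subspaceB Lsq_subspace hL (fL m).
rewrite sub0r normrN ger0_norm ?ip_ge0// -lee_fin.
rewrite (ip_EFin (subspaceB Lsq_subspace (fL m) hL)).
apply: le_trans (key e m e0 _); last by move=> k mk; apply: fe => //; exact: leq_trans nm mk.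
rewrite le_eqVlt; apply/orP; left; apply/eqP; apply: eq_integral => x _.
by congr EFin; rewrite -[RHS]sqrrN opprB.
Qed.
End SquareIntegrable.

(** * Calculus in the plane *)
Lemma integral_vanish d (T : measurableType d) (R : realType)
    (mu : {measure set T -> \bar R}) (D : set T) (f : T -> \bar R) :
  (forall x, ~ D x -> f x = 0%E) ->
  (\int[mu]_(x in D) f x = \int[mu]_x f x)%E.
Proof.
move=> f0; rewrite integral_mkcond; apply: eq_integral => x _.
by rewrite patchE; case: ifPn => // /negP xD; rewrite f0// => Dx; apply: xD; rewrite inE.
Qed.

Section Plane.
Context {R : realType}.
Local Notation plane := (R * R)%type.
Local Notation leb := (@lebesgue_measure R).
Local Notation area := (leb \x leb)%E.
Implicit Types f g : plane -> R.

(** An open set is the union of the squares with rational centre and inverse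
    integer half-side that it contains. *)
Lemma open_plane_measurable (U : set plane) : open U -> measurable U.
Proof.
move=> oU.
pose B (i : rat * rat * nat) : set plane :=
  ball (ratr i.1.1 : R) i.2.+1%:R^-1 `*` ball (ratr i.1.2 : R) i.2.+1%:R^-1.
pose F i : set plane := if `[< B i `<=` U >] then B i else set0.
have -> : U = \bigcup_i F i.
  apply/seteqP; split => [x Ux|x [i _]]; last first.
    by rewrite /F; case: asboolP => // BU /BU.
  have /nbhs_ballP[_/posnumP[e] eU] : nbhs x U by exact: open_nbhs_nbhs.
  have [n n0 ne] : exists2 n, (0 < n)%N & n%:R^-1 < e%:num / 2.
    have [N _ hN] := near_infty_natSinv_lt (PosNum (divr_gt0 [gt0 of e%:num] (ltr0n R 2))).
    by exists N.+1 => //; exact: (hN N (leqnn N)).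
  have pick (y : R) : exists r : rat, ball y n%:R^-1 (ratr r).
    have [z [yr [r _ rE]]] : (ball y n%:R^-1 `&` (@ratr R @` setT)) !=set0.
      apply: dense_rat; last exact: ball_open.
      by exists y; apply: ballxx; rewrite invr_gt0 ltr0n.
    by exists r; rewrite rE.
  have [r1 h1] := pick x.1; have [r2 h2] := pick x.2.
  exists (r1, r2, n.-1) => //; rewrite /F.
  have BU : B (r1, r2, n.-1) `<=` U.
    move=> y []; rewrite /= prednK// => b1 b2; apply: eU.
    have half : n%:R^-1 + n%:R^-1 <= e%:num.
      by rewrite [leRHS]splitr lerD// ltW.
    by split; apply: le_ball half _ _; [exact: ball_triangle h1 b1|exact: ball_triangle h2 b2].
  rewrite asboolT//.
  by split; rewrite /= prednK//; exact: ball_sym.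
apply: countable_bigcupT_measurable => [|i]; first exact: countableP.
rewrite /F; case: asboolP => // _.
by apply: measurableX; exact: measurable_ball.
Qed.

Lemma continuous_plane_measurable f : continuous f -> measurable_fun setT f.
Proof.
move=> /continuousP cf; apply: (measurability _ (RGenOpens.measurableE R)).
move=> _ [_ [a [b ->] <-]]; rewrite setTI; apply: open_plane_measurable.
exact/cf/interval_open.
Qed.

Lemma lebesgue_segment (a b : R) : a <= b -> leb `[a, b]%classic = (b - a)%:E.
Proof.
rewrite le_eqVlt => /predU1P[->|ab]; first by rewrite set_itv1 lebesgue_measure_set1 subrr.
by rewrite lebesgue_measure_itv/= lte_fin ab.
Qed.

Lemma area_rect (a b c e : R) : a <= b -> c <= e ->
  area (`[a, b] `*` `[c, e]) = ((b - a) * (e - c))%:E.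
Proof.
move=> ab ce; transitivity (leb `[a, b]%classic * leb `[c, e]%classic)%E.
  exact: product_measure1E.
by rewrite !lebesgue_segment.
Qed.

(** Stated without a closure, this form of bounded support passes to products
    and to sections at once. *)
Definition boxed (M : R) f := forall x, f x != 0 -> `|x.1| <= M /\ `|x.2| <= M.

Lemma compact_box (K : set plane) : compact K ->
  exists2 M : R, 0 < M & forall x, K x -> `|x.1| <= M /\ `|x.2| <= M.
Proof.
move=> /compact_bounded[M [_ Mf]]; exists (`|M| + 1) => [|x Kx].
  by rewrite ltr_wpDl.
have M1 : M < `|M| + 1 by rewrite (le_lt_trans (ler_norm _))// ltrDl.
by have := Mf _ M1 x Kx; rewrite /= ge_max => /andP.
Qed.

Lemma boxed_bounded M f : continuous f -> boxed M f ->
  exists2 C, 0 <= C & forall x, `|f x| <= C.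
Proof.
move=> cf bf.
have cK : compact (`[- M, M] `*` `[- M, M] : set plane).
  by apply: compact_setX; exact: segment_compact.
have /compact_bounded[C [_ fC]] :=
  continuous_compact (continuous_subspaceT cf) cK.
exists (`|C| + 1) => [|x]; first by rewrite addr_ge0.
have [->|fx] := eqVneq (f x) 0; first by rewrite normr0 addr_ge0.
apply: (fC (`|C| + 1)); first by rewrite (le_lt_trans (ler_norm _))// ltrDl.
exists x => //; have [h1 h2] := bf x fx.
by split; rewrite /= in_itv/= -ler_norml.
Qed.

Lemma boxed_integrable M f : continuous f -> boxed M f ->
  area.-integrable setT (EFin \o f).
Proof.
move=> cf bf; have [C C0 fC] := boxed_bounded cf bf.
have mf := continuous_plane_measurable cf.
apply/integrableP; split; first exact/measurable_EFinP.
pose K : set plane := `[- M, M] `*` `[- M, M].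
have mK : measurable K by exact: measurableX.
apply: (@le_lt_trans _ _ (\int[area]_x (C * \1_K x)%:E)%E).
  apply: ge0_le_integral => //=.
  - by apply/measurable_EFinP; exact: measurableT_comp.
  - by apply/measurable_EFinP; apply: measurable_funM => //; exact: measurable_indic.
  - move=> x _; rewrite lee_fin; have [->|fx] := eqVneq (f x) 0.
      by rewrite normr0 mulr_ge0.
    have [h1 h2] := bf x fx.
    by rewrite indicE mem_set ?mulr1//; split; rewrite /= in_itv/= -ler_norml.
under eq_integral do rewrite EFinM.
rewrite ge0_integralZl_EFin//; last exact/measurable_EFinP/measurable_indic.
rewrite integral_indic// setIT; have [M0|M0] := leP 0 M.
  have M2 : - M <= M by lra.
  by rewrite [X in (_ * X)%E](area_rect M2 M2) -EFinM ltry.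
have -> : K = set0 by apply/seteqP; split=> // -[x y] [/=]; rewrite !in_itv/= => /andP[]; lra.
by rewrite measure0 mule0 ltry.
Qed.

Lemma boxedM M f g : boxed M f -> boxed M (fun x => f x * g x).
Proof. by move=> bf x; rewrite mulf_eq0 negb_or => /andP[/bf]. Qed.

Lemma boxed_Lsq M f : continuous f -> boxed M f -> Lsq area f.
Proof.
move=> cf bf; split; first exact: continuous_plane_measurable.
have /integrableP[_] : area.-integrable setT (EFin \o (fun x => f x * f x)).
  apply: (@boxed_integrable M); last exact: boxedM.
  by move=> x; apply: cvgM; exact: cf.
apply: le_lt_trans; apply: ge0_le_integral => //=.
- by move=> x _; rewrite lee_fin sqr_ge0.
- by apply/measurable_EFinP/measurable_funX; exact: continuous_plane_measurable.
- apply/measurable_EFinP; apply: measurableT_comp => //.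
  by apply: measurable_funM; exact: continuous_plane_measurable.
- by move=> x _; rewrite lee_fin -expr2 ler_norm.
Qed.

(** The difference quotient of [f] along a coordinate direction is that of a
    section of [f], so both partial derivatives are one-variable derivatives. *)
Lemma growth_rate1 f a b :
  (fun h : R => h^-1 *: ((f \o shift (a, b)) (h *: ((1, 0) : plane)) - f (a, b))) =
  (fun h : R => h^-1 *: (((fun t => f (t, b)) \o shift a) (h *: (1 : R)) - f (a, b))).
Proof.
apply/funext => h /=; congr (_ *: (f _ - _)).
by congr pair; rewrite /= /GRing.scale/= mulr0 add0r.
Qed.

Lemma growth_rate2 f a b :
  (fun h : R => h^-1 *: ((f \o shift (a, b)) (h *: ((0, 1) : plane)) - f (a, b))) =
  (fun h : R => h^-1 *: (((fun t => f (a, t)) \o shift b) (h *: (1 : R)) - f (a, b))).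
Proof.
apply/funext => h /=; congr (_ *: (f _ - _)).
by congr pair; rewrite /= /GRing.scale/= mulr0 add0r.
Qed.

Lemma derivable_section1 f a b :
  derivable f (a, b) (1, 0) = derivable (fun t => f (t, b)) a 1.
Proof. by rewrite /derivable growth_rate1. Qed.

Lemma derivable_section2 f a b :
  derivable f (a, b) (0, 1) = derivable (fun t => f (a, t)) b 1.
Proof. by rewrite /derivable growth_rate2. Qed.

Lemma d1_section f a b : d1 f (a, b) = derive1 (fun t => f (t, b)) a.
Proof. by rewrite /d1 derive1E /derive growth_rate1. Qed.

Lemma d2_section f a b : d2 f (a, b) = derive1 (fun t => f (a, t)) b.
Proof. by rewrite /d2 derive1E /derive growth_rate2. Qed.

Lemma continuous_section1 f b : continuous f -> continuous (fun t => f (t, b)).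
Proof.
move=> cf t; apply: (@continuous_comp _ _ _ (fun t => (t, b)) f); last exact: cf.
exact: (cvg_pair (@cvg_id _ (nbhs t)) (cvg_cst b)).
Qed.

Lemma continuous_section2 f a : continuous f -> continuous (fun t => f (a, t)).
Proof.
move=> cf t; apply: (@continuous_comp _ _ _ (fun t => (a, t)) f); last exact: cf.
exact: (cvg_pair (cvg_cst a) (@cvg_id _ (nbhs t))).
Qed.

Lemma FTC_derive (g : R -> R) (a b : R) : a <= b -> (forall x, derivable g x 1) ->
  continuous (derive1 g) ->
  (\int[leb]_(x in `[a, b]) (derive1 g x)%:E = (g b - g a)%:E)%E.
Proof.
rewrite le_eqVlt => /predU1P[-> _ _|ab dg cg].
  by rewrite set_itv1 integral_set1 subrr.
have cg0 : continuous g.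
  by move=> x; apply/differentiable_continuous/derivable1_diffP.
have cd : {within `[a, b], continuous (derive1 g)} by exact: continuous_subspaceT.
have h : derivable_oo_LRcontinuous g a b.
  by split=> [x _//||]; [exact/cvg_at_right_filter/cg0|exact/cvg_at_left_filter/cg0].
rewrite EFinB; exact: (continuous_FTC2 ab cd h (fun _ _ => erefl)).
Qed.

Lemma integral_derive_boxed (g : R -> R) M : 0 < M -> (forall x, derivable g x 1) ->
  continuous (derive1 g) -> (forall x, g x != 0 -> `|x| <= M) ->
  (forall x, derive1 g x != 0 -> `|x| <= M) ->
  (\int[leb]_x (derive1 g x)%:E = 0)%E.
Proof.
move=> M0 dg cg bg bg'.
have M1 : M < M + 1 by rewrite ltrDl.
have out x : M + 1 <= `|x| -> g x = 0.
  by move=> xM; apply/eqP; apply: contraTT xM => /bg h; rewrite -ltNge (le_lt_trans h).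
have M2 : - (M + 1) <= M + 1 by lra.
rewrite -(@integral_vanish _ _ _ leb `[- (M + 1), M + 1]).
  rewrite FTC_derive// !out ?subrr// ?normrN ger0_norm//; lra.
move=> x /=; rewrite in_itv/= -ler_norml => /negP xM; apply/eqP.
rewrite -[_ == _]/(derive1 g x == 0); apply: contraNT xM => /bg' h; lra.
Qed.

End Plane.

(** * Test functions and integration by parts *)
Section TestFunctions.
Context {R : realType}.
Local Notation plane := (R * R)%type.
Local Notation leb := (@lebesgue_measure R).
Local Notation area := (leb \x leb)%E.
Implicit Types (f g phi chi : plane -> R) (Omega : set plane).

Lemma integral_d1_boxed M f : 0 < M -> Ck 1 f -> boxed M f -> boxed M (d1 f) ->
  \int[area]_x d1 f x = 0.
Proof.
move=> M0 [cf [df1 _ [cf1 _] _]] bf bf1.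
rewrite /Rintegral -(@integral21_prod_meas1 _ _ _ _ _ leb leb (EFin \o d1 f)); last first.
  exact: boxed_integrable bf1.
rewrite integral0_eq// => y _.
have e t : d1 f (t, y) = derive1 (fun t => f (t, y)) t by exact: d1_section.
transitivity (\int[leb]_t (derive1 (fun t => f (t, y)) t)%:E)%E.
  by apply: eq_integral => t _ /=; rewrite e.
apply: (integral_derive_boxed M0).
- by move=> t; rewrite -derivable_section1.
- rewrite (_ : derive1 _ = fun t => d1 f (t, y)); last by apply/funext => t; rewrite e.
  exact: continuous_section1.
- by move=> t /bf[].
- by move=> t; rewrite -e => /bf1[].
Qed.

Lemma integral_d2_boxed M f : 0 < M -> Ck 1 f -> boxed M f -> boxed M (d2 f) ->
  \int[area]_x d2 f x = 0.
Proof.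
move=> M0 [cf [_ df2 _ [cf2 _]]] bf bf2.
rewrite /Rintegral -(@integral12_prod_meas1 _ _ _ _ _ leb leb (EFin \o d2 f)); last first.
  exact: boxed_integrable bf2.
rewrite integral0_eq// => x _.
have e t : d2 f (x, t) = derive1 (fun t => f (x, t)) t by exact: d2_section.
transitivity (\int[leb]_t (derive1 (fun t => f (x, t)) t)%:E)%E.
  by apply: eq_integral => t _ /=; rewrite e.
apply: (integral_derive_boxed M0).
- by move=> t; rewrite -derivable_section2.
- rewrite (_ : derive1 _ = fun t => d2 f (x, t)); last by apply/funext => t; rewrite e.
  exact: continuous_section2.
- by move=> t /bf[].
- by move=> t; rewrite -e => /bf2[].
Qed.

(** Off its support a function vanishes in a neighbourhood. *)
Lemma derive_support (v : plane) f x : 'D_v f x != 0 -> fsupport f x.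
Proof.
move=> dx B Bx; apply: contrapT => h.
have f0 : \near x, f x = cst 0 x.
  apply: filterS Bx => y By; apply: contrapT => fy; apply: h.
  by exists y; split=> //; apply/eqP.
by move: dx; rewrite (near_eq_derive v f0) derive_cst eqxx.
Qed.

Lemma fsupport_derive (v : plane) f : fsupport ('D_v f) `<=` fsupport f.
Proof.
rewrite [X in _ `<=` X](iffLR (closure_id _) (@closed_closure _ _)).
by apply: closureS => x; exact: derive_support.
Qed.

Lemma Ck_lin k (a : R) f g : Ck k f -> Ck k g -> Ck k (a *: f + g).
Proof.
elim: k f g => [|k IH] f g; first by move=> [cf _] [cg _]; split=> // x; apply: cvgD; [apply: cvgZl_tmp|]; [exact: cf|exact: cg].
move=> [cf [df1 df2 Cf1 Cf2]] [cg [dg1 dg2 Cg1 Cg2]]; split.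
  by move=> x; apply: cvgD; [apply: cvgZl_tmp|]; [exact: cf|exact: cg].
have e (v : plane) : (forall x, derivable f x v) -> (forall x, derivable g x v) ->
    'D_v (a *: f + g) = a *: 'D_v f + 'D_v g.
  move=> df dg; apply/funext => x; rewrite deriveD ?deriveZ//; exact: derivableZ.
split.
- by move=> x; apply: derivableD => //; exact: derivableZ.
- by move=> x; apply: derivableD => //; exact: derivableZ.
- by rewrite /d1 e//; exact: IH.
- by rewrite /d2 e//; exact: IH.
Qed.

Lemma Ck_pred k f : Ck k.+1 f -> Ck k f.
Proof.
elim: k f => [|k IH] f [cf [df1 df2 Cf1 Cf2]]; first by split.
split; first exact: cf.
by split; [exact: df1|exact: df2|exact: IH Cf1|exact: IH Cf2].
Qed.

Lemma derive_mul (v : plane) f g : (forall x, derivable f x v) ->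
  (forall x, derivable g x v) -> 'D_v (f * g) = f * 'D_v g + 'D_v f * g.
Proof.
move=> df dg; apply/funext => x; rewrite deriveM//.
by rewrite [in LHS]/GRing.scale/= [g x * _]mulrC.
Qed.

Lemma Ck_mul k f g : Ck k f -> Ck k g -> Ck k (f * g).
Proof.
have cM (u w : plane -> R) : continuous u -> continuous w -> continuous (u * w).
  by move=> cu cw x; apply: cvgM; [exact: cu|exact: cw].
elim: k f g => [|k IH] f g Cf Cg; first by split=> //; apply: cM; [case: Cf|case: Cg].
have [Cf' Cg'] := (Ck_pred Cf, Ck_pred Cg).
have [cf [df1 df2 Cf1 Cf2]] := Cf; have [cg [dg1 dg2 Cg1 Cg2]] := Cg.
split; first exact: cM cf cg.
split; [by move=> x; exact: derivableM|by move=> x; exact: derivableM| |].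
- rewrite /d1 derive_mul// -[f * _]scale1r; apply: Ck_lin.
    exact: IH Cf' Cg1.
  exact: IH Cf1 Cg'.
- rewrite /d2 derive_mul// -[f * _]scale1r; apply: Ck_lin.
    exact: IH Cf' Cg2.
  exact: IH Cf2 Cg'.
Qed.

Lemma test0 Omega : test_function Omega 0.
Proof.
have s0 : fsupport (0 : plane -> R) = set0.
  by rewrite /fsupport (_ : [set _ | _] = set0) ?closure0//; apply/seteqP; split => // x /=; rewrite eqxx.
split; rewrite ?s0//; last exact: compact0.
have d0 (v : plane) : 'D_v (0 : plane -> R) = 0 by apply/funext => x; exact: (derive_cst 0).
elim=> [|k IH]; split => //; try by move=> x; exact: cvg_cst.
by split=> [x|x||]; rewrite ?/d1 ?/d2 ?d0//; exact: derivable_cst.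
Qed.

Lemma test_lin Omega (a : R) phi chi :
  test_function Omega phi -> test_function Omega chi ->
  test_function Omega (a *: phi + chi).
Proof.
move=> [sp cp op] [sc cc oc].
have sub : fsupport (a *: phi + chi) `<=` fsupport phi `|` fsupport chi.
  rewrite -closureU; apply: closureS => x /= h; apply: contrapT.
  move=> /not_orP[/= /negP/negPn/eqP h1 /negP/negPn/eqP h2].
  have : a * phi x + chi x != 0 by exact: h.
  by rewrite h1 h2 mulr0 addr0 eqxx.
split; first by move=> k; apply: Ck_lin; [exact: sp|exact: sc].
  by apply: subclosed_compact (compactU cp cc) sub; exact: closed_closure.
by move=> x /sub[/op|/oc].
Qed.

Lemma test_d1 Omega phi : test_function Omega phi -> test_function Omega (d1 phi).
Proof.
move=> [sp cp op]; split; first by move=> k; case: (sp k.+1) => _ [].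
  by apply: subclosed_compact cp _; [exact: closed_closure|exact: fsupport_derive].
by move=> x /fsupport_derive/op.
Qed.

Lemma test_d2 Omega phi : test_function Omega phi -> test_function Omega (d2 phi).
Proof.
move=> [sp cp op]; split; first by move=> k; case: (sp k.+1) => _ [].
  by apply: subclosed_compact cp _; [exact: closed_closure|exact: fsupport_derive].
by move=> x /fsupport_derive/op.
Qed.

Lemma test_box Omega phi : test_function Omega phi ->
  exists2 M, 0 < M & [/\ boxed M phi, boxed M (d1 phi) & boxed M (d2 phi)].
Proof.
move=> [_ /compact_box[M M0 MK] _]; exists M => //.
by split=> x fx; apply: MK; [exact: subset_closure|exact: derive_support fx|exact: derive_support fx].
Qed.

Lemma test_C1 Omega phi : test_function Omega phi -> Ck 1 phi.
Proof. by move=> [+ _ _]; exact. Qed.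

Lemma test_continuous Omega phi : test_function Omega phi -> continuous phi.
Proof. by move=> /test_C1[]. Qed.

Lemma test_Lsq Omega phi : test_function Omega phi -> Lsq area phi.
Proof.
move=> tphi; have [M _ [bp _ _]] := test_box tphi.
by apply: boxed_Lsq bp; exact: test_continuous tphi.
Qed.

Lemma test_out Omega phi x : test_function Omega phi -> ~ Omega x -> phi x = 0.
Proof.
move=> [_ _ op] ox; apply/eqP/negPn/negP => px; apply: ox.
by apply: op; exact: subset_closure.
Qed.

Lemma test_mul Omega phi chi : test_function Omega phi -> test_function Omega chi ->
  test_function Omega (phi * chi).
Proof.
move=> [sp cp op] [sc cc oc].
have sub : fsupport (phi * chi) `<=` fsupport phi.
  apply: closureS => x /= h; have : phi x * chi x != 0 by exact: h.
  by apply: contra_neq => ->; rewrite mul0r.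
split; first by move=> k; apply: Ck_mul; [exact: sp|exact: sc].
  by apply: subclosed_compact cp sub; exact: closed_closure.
by move=> x /sub/op.
Qed.

(** The derivative of [phi * chi] has integral [0] since [phi * chi] has compact
    support. *)
Lemma test_ibp1 Omega phi chi : test_function Omega phi -> test_function Omega chi ->
  ip area phi (d1 chi) = - ip area (d1 phi) chi.
Proof.
move=> tp tc; have tm := test_mul tp tc; have [M M0 [bm bm1 _]] := test_box tm.
have := integral_d1_boxed M0 (test_C1 tm) bm bm1.
have [_ [dp _ _ _]] := test_C1 tp; have [_ [dc _ _ _]] := test_C1 tc.
rewrite /d1 derive_mul// RintegralD//.
- by move/eqP; rewrite addr_eq0 => /eqP.
- by apply: LsqM_integrable; [exact: test_Lsq tp|exact: test_Lsq (test_d1 tc)].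
- by apply: LsqM_integrable; [exact: test_Lsq (test_d1 tp)|exact: test_Lsq tc].
Qed.

Lemma test_ibp2 Omega phi chi : test_function Omega phi -> test_function Omega chi ->
  ip area phi (d2 chi) = - ip area (d2 phi) chi.
Proof.
move=> tp tc; have tm := test_mul tp tc; have [M M0 [bm _ bm2]] := test_box tm.
have := integral_d2_boxed M0 (test_C1 tm) bm bm2.
have [_ [_ dp _ _]] := test_C1 tp; have [_ [_ dc _ _]] := test_C1 tc.
rewrite /d2 derive_mul// RintegralD//.
- by move/eqP; rewrite addr_eq0 => /eqP.
- by apply: LsqM_integrable; [exact: test_Lsq tp|exact: test_Lsq (test_d2 tc)].
- by apply: LsqM_integrable; [exact: test_Lsq (test_d2 tp)|exact: test_Lsq tc].
Qed.
End TestFunctions.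

(** * The form domain *)
Section FormSpace.
Context {R : realType}.
Local Notation plane := (R * R)%type.
Local Notation leb := (@lebesgue_measure R).
Local Notation area := (leb \x leb)%E.
Local Notation V := ((plane -> R) * ((plane -> R) * (plane -> R)))%type.
Variable Omega : set plane.
Implicit Types (u w f g h : plane -> R) (U W : V).

Definition mass U W := ip area U.1 W.1.
Definition energy U W := ip area U.2.1 W.2.1 + ip area U.2.2 W.2.2.

Definition jet (phi : plane -> R) : V := (phi, (d1 phi, d2 phi)).

Definition Lsq3 : set V := [set U | [/\ Lsq area U.1, Lsq area U.2.1 & Lsq area U.2.2]].

(** The closure of the test functions in the graph norm. Its elements carry
    their gradient as two further components, so that the Dirichlet form is a
    function of the element itself; that these components are the weak
    gradient is a consequence. *)
Definition form_space : set V := [set U | Lsq3 U /\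
  forall e, 0 < e -> exists2 phi, test_function Omega phi &
    mass (U - jet phi) (U - jet phi) + energy (U - jet phi) (U - jet phi) < e].

Lemma Lsq_lin (a : R) f g : Lsq area f -> Lsq area g -> Lsq area (a *: f + g).
Proof. by move=> Lf Lg; exact: ((@Lsq_subspace _ _ R area).2 a f g Lf Lg). Qed.

Lemma ip_lin (a : R) f g h : Lsq area f -> Lsq area g -> Lsq area h ->
  ip area (a *: f + g) h = a * ip area f h + ip area g h.
Proof. by move=> Lf Lg Lh; exact: ((@ip_form _ _ R area).2 a f g h Lf Lg Lh). Qed.

Lemma ip_sym f g : ip area f g = ip area g f.
Proof. exact: ((@ip_form _ _ R area).1 f g). Qed.

Lemma Lsq3_subspace : subspace Lsq3.
Proof.
split=> [|a U W [U1 U2 U3] [W1 W2 W3]].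
  by split; exact: (@Lsq_subspace _ _ R area).1.
by split; [exact: (Lsq_lin a U1 W1)|exact: (Lsq_lin a U2 W2)|exact: (Lsq_lin a U3 W3)].
Qed.

Lemma mass_form : form_on Lsq3 mass.
Proof.
split=> [U W|a U W X [U1 _ _] [W1 _ _] [X1 _ _]]; first exact: (ip_sym U.1 W.1).
exact: (ip_lin a U1 W1 X1).
Qed.

Lemma energy_form : form_on Lsq3 energy.
Proof.
split=> [U W|a U W X [_ U2 U3] [_ W2 W3] [_ X2 X3]].
  exact: (congr2 +%R (ip_sym U.2.1 W.2.1) (ip_sym U.2.2 W.2.2)).
apply: (etrans (congr2 +%R (ip_lin a U2 W2 X2) (ip_lin a U3 W3 X3))).
by rewrite /energy mulrDr addrACA.
Qed.

Definition graph_form U W := mass U W + energy U W.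

Lemma graph_form_form : form_on Lsq3 graph_form.
Proof.
have [s l] := mass_form; have [s' l'] := energy_form.
split=> [U W|a U W X LU LW LX]; rewrite /graph_form; first by rewrite s s'.
by rewrite l// l'//; ring.
Qed.

Lemma mass_ge0 U : 0 <= mass U U. Proof. exact: ip_ge0. Qed.
Lemma energy_ge0 U : 0 <= energy U U. Proof. by rewrite addr_ge0 ?ip_ge0. Qed.
Lemma graph_form_ge0 U : 0 <= graph_form U U.
Proof. by rewrite addr_ge0 ?mass_ge0 ?energy_ge0. Qed.

Lemma jet_Lsq3 phi : test_function Omega phi -> Lsq3 (jet phi).
Proof.
move=> t; split; [exact: test_Lsq t|exact: test_Lsq (test_d1 t)|exact: test_Lsq (test_d2 t)].
Qed.

Lemma jet_lin (a : R) phi chi : test_function Omega phi -> test_function Omega chi ->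
  jet (a *: phi + chi) = a *: jet phi + jet chi.
Proof.
move=> tp tc; have [_ [dp1 dp2 _ _]] := test_C1 tp; have [_ [dc1 dc2 _ _]] := test_C1 tc.
rewrite /jet; congr (_, (_, _)).
- apply/funext => x; rewrite /d1 deriveD ?deriveZ//; exact: derivableZ.
- apply/funext => x; rewrite /d2 deriveD ?deriveZ//; exact: derivableZ.
Qed.

Lemma form_space_jet phi : test_function Omega phi -> form_space (jet phi).
Proof.
move=> t; split; first exact: jet_Lsq3.
move=> e e0; exists phi => //; rewrite subrr.
by rewrite (form0l Lsq3_subspace mass_form) ?(form0l Lsq3_subspace energy_form) ?addr0//; exact: Lsq3_subspace.1.
Qed.

Lemma graph_formD U W : Lsq3 U -> Lsq3 W ->
  graph_form (U + W) (U + W) <= 2 * graph_form U U + 2 * graph_form W W.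
Proof.
move=> LU LW; have := form_parallelogram Lsq3_subspace graph_form_form LU LW.
have := graph_form_ge0 (U - W).
by move: (graph_form U U) (graph_form W W) (graph_form (U + W) _) (graph_form (U - W) _) => x y z t; clear; lra.
Qed.

Lemma form_space_subspace : subspace form_space.
Proof.
have sL := Lsq3_subspace.
split=> [|a U W [LU hU] [LW hW]].
  have := form_space_jet (test0 Omega); rewrite (_ : jet 0 = 0)//.
  have := jet_lin 0 (test0 Omega) (test0 Omega); rewrite scale0r addr0 scale0r add0r.
  have := jet_lin (-1) (test0 Omega) (test0 Omega).
  by rewrite scaler0 addr0 scaleN1r addNr.
split; first exact: sL.2.
move=> e e0.
have [phi tp hp] := hU (e / (4 * (a ^+ 2 + 1))) ltac:(by rewrite divr_gt0// mulr_gt0// ltr_wpDl ?sqr_ge0).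
have [chi tc hc] := hW (e / 4) ltac:(by rewrite divr_gt0).
exists (a *: phi + chi); first exact: test_lin.
have Lp := jet_Lsq3 tp; have Lc := jet_Lsq3 tc.
rewrite jet_lin// opprD addrACA -scalerBr -/(graph_form _ _).
have L1 := subspaceB sL LU Lp; have L2 := subspaceB sL LW Lc.
apply: le_lt_trans (graph_formD (subspaceZ a sL L1) L2) _.
rewrite (formZl sL graph_form_form)//; last exact: subspaceZ.
rewrite graph_form_form.1 (formZl sL graph_form_form)// mulrA -expr2.
rewrite -/(graph_form _ _) in hp; rewrite -/(graph_form _ _) in hc.
have : a ^+ 2 * graph_form (U - jet phi) (U - jet phi) <= e / 4.
  move: hp; rewrite ltr_pdivlMr ?mulr_gt0 ?ltr_wpDl ?sqr_ge0// => /ltW.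
  have := graph_form_ge0 (U - jet phi).
  move: (graph_form _ _) (a ^+ 2) => x y; lra.
move: hc; move: (graph_form (U - jet phi) _) (graph_form (W - jet chi) _) (a ^+ 2) => x y z.
clear; lra.
Qed.

(** The three components converge in L^2 separately; the limit is approximated
    by the jets that approximate a late term of the sequence. *)
Lemma form_space_complete (U : nat -> V) : (forall n, form_space (U n)) ->
  (forall e, 0 < e -> exists N, forall m n, (N <= m)%N -> (N <= n)%N ->
     mass (U m - U n) (U m - U n) + energy (U m - U n) (U m - U n) < e) ->
  exists L, [/\ form_space L, (fun n => mass (U n - L) (U n - L)) @ \oo --> 0 &
    (fun n => energy (U n - L) (U n - L)) @ \oo --> 0].
Proof.
move=> HU C.
have [l1 L1 c1] : exists2 h, Lsq area h &
    (fun n => ip area ((U n).1 - h) ((U n).1 - h)) @ \oo --> 0.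
  apply: riesz_fischer => [n|e e0]; first by case: (HU n) => -[].
  have [N hN] := C e e0; exists N => m n Nm Nn; apply: le_lt_trans (hN m n Nm Nn).
  by rewrite lerDl energy_ge0.
have [l2 L2 c2] : exists2 h, Lsq area h &
    (fun n => ip area ((U n).2.1 - h) ((U n).2.1 - h)) @ \oo --> 0.
  apply: riesz_fischer => [n|e e0]; first by case: (HU n) => -[].
  have [N hN] := C e e0; exists N => m n Nm Nn; apply: le_lt_trans (hN m n Nm Nn).
  by rewrite /energy addrCA lerDl addr_ge0 ?ip_ge0.
have [l3 L3 c3] : exists2 h, Lsq area h &
    (fun n => ip area ((U n).2.2 - h) ((U n).2.2 - h)) @ \oo --> 0.
  apply: riesz_fischer => [n|e e0]; first by case: (HU n) => -[].
  have [N hN] := C e e0; exists N => m n Nm Nn; apply: le_lt_trans (hN m n Nm Nn).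
  by rewrite /energy addrA lerDr addr_ge0 ?ip_ge0.
pose L : V := (l1, (l2, l3)).
have LL : Lsq3 L by [].
have ce : (fun n => energy (U n - L) (U n - L)) @ \oo --> 0.
  by rewrite -[X in _ --> X](addr0 (0 : R)); exact: cvgD.
exists L; split => //; split=> // e e0.
have : (fun n => graph_form (U n - L) (U n - L)) @ \oo --> (0 + 0 : R) by exact: cvgD.
rewrite addr0 => /cvgrPdist_lt/(_ (e / 8)) [|N _ /(_ N (leqnn N))]; first by rewrite divr_gt0.
rewrite /= sub0r normrN ger0_norm ?graph_form_ge0// => hN.
have [LN /(_ (e / 8)) [|phi tp hp]] := HU N; first by rewrite divr_gt0.
exists phi => //; have sL := Lsq3_subspace; have Lp := jet_Lsq3 tp.
rewrite -/(graph_form _ _) in hp *.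
have -> : L - jet phi = (-1) *: (U N - L) + (U N - jet phi).
  by rewrite scaleN1r opprB addrA subrK.
have LNL := subspaceB sL LN LL.
apply: le_lt_trans (graph_formD (subspaceZ _ sL LNL) (subspaceB sL LN Lp)) _.
rewrite (formZl sL graph_form_form)//; last exact: subspaceZ.
rewrite graph_form_form.1 (formZl sL graph_form_form)//; move: hp hN.
by move: (graph_form (U N - L) _) (graph_form (U N - jet phi) _) => x y; clear -e0; lra.
Qed.

(** Identities that are linear and continuous in an element of the form domain
    pass from jets to the whole domain. *)
Lemma form_space_annihilator W U : Lsq3 W ->
  (forall phi, test_function Omega phi -> graph_form (jet phi) W = 0) ->
  form_space U -> graph_form U W = 0.
Proof.
move=> LW h [LU hU]; have sL := Lsq3_subspace.
have key e : 0 < e -> graph_form U W ^+ 2 <= e * graph_form W W.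
  move=> e0; have [phi tp hp] := hU e e0; have Lp := jet_Lsq3 tp.
  have -> : graph_form U W = graph_form (U - jet phi) W.
    by rewrite (formBl graph_form_form)// h// subr0.
  apply: le_trans (form_CS sL graph_form_form _ (subspaceB sL LU Lp) LW) _.
    by move=> *; exact: graph_form_ge0.
  by rewrite ler_wpM2r ?graph_form_ge0// ltW.
apply/eqP; rewrite -sqrf_eq0 eq_le sqr_ge0 andbT; apply/ler_addgt0Pr => e e0.
rewrite add0r; have gW := graph_form_ge0 W.
apply: le_trans (key (e / (graph_form W W + 1)) _) _.
  by rewrite divr_gt0// ltr_wpDl.
rewrite mulrAC ler_pdivrMr ?ltr_wpDl// ler_pM2l//; lra.
Qed.
End FormSpace.

(** * From the form to the operator *)
Section Operator.
Context {R : realType}.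
Local Notation plane := (R * R)%type.
Local Notation leb := (@lebesgue_measure R).
Local Notation area := (leb \x leb)%E.
Local Notation V := ((plane -> R) * ((plane -> R) * (plane -> R)))%type.
Variable Omega : set plane.
Hypothesis mOmega : measurable Omega.
Implicit Types (u w chi : plane -> R) (U W : V).

Lemma ip_restrict u chi : test_function Omega chi ->
  \int[area]_(x in Omega) (u x * chi x) = ip area u chi.
Proof.
move=> tc; rewrite /ip /Rintegral integral_vanish// => x /(test_out tc) ->.
by rewrite mulr0.
Qed.

Lemma ipr0 u : Lsq area u -> ip area u 0 = 0.
Proof.
move=> Lu; rewrite (@ip_form _ _ R area).1.
exact: (form0l (@Lsq_subspace _ _ R area) (@ip_form _ _ R area)).
Qed.

Lemma Lsq0 : Lsq area (0 : plane -> R).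
Proof. exact: (@Lsq_subspace _ _ R area).1. Qed.

Lemma ipDr u w chi : Lsq area u -> Lsq area w -> Lsq area chi ->
  ip area u (w + chi) = ip area u w + ip area u chi.
Proof.
move=> Lu Lw Lc; have [s _] := @ip_form _ _ R area.
by rewrite s (formDl (@ip_form _ _ R area) Lw Lc Lu); congr (_ + _); exact: s.
Qed.

(** The identity says that [U] is orthogonal to the triple [(d1 chi, (chi, 0))],
    which is true when [U] is a jet. *)
Lemma form_space_ibp1 U chi : form_space Omega U -> test_function Omega chi ->
  ip area U.1 (d1 chi) = - ip area U.2.1 chi.
Proof.
move=> HU tc; pose W : V := (d1 chi, (chi, 0)).
have LW : Lsq3 W by split; [exact: test_Lsq (test_d1 tc)|exact: test_Lsq tc|exact: Lsq0].
have : graph_form U W = 0.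
  apply: (form_space_annihilator LW) HU => phi tp.
  rewrite /graph_form /mass /energy /= (ipr0 (test_Lsq (test_d2 tp))) addr0.
  by rewrite (test_ibp1 tp tc) addNr.
case: HU => -[U1 U2 U3] _; rewrite /graph_form /mass /energy /= ipr0// addr0.
by move/eqP; rewrite addr_eq0 => /eqP.
Qed.

Lemma form_space_ibp2 U chi : form_space Omega U -> test_function Omega chi ->
  ip area U.1 (d2 chi) = - ip area U.2.2 chi.
Proof.
move=> HU tc; pose W : V := (d2 chi, (0, chi)).
have LW : Lsq3 W by split; [exact: test_Lsq (test_d2 tc)|exact: Lsq0|exact: test_Lsq tc].
have : graph_form U W = 0.
  apply: (form_space_annihilator LW) HU => phi tp.
  rewrite /graph_form /mass /energy /= (ipr0 (test_Lsq (test_d1 tp))) add0r.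
  by rewrite (test_ibp2 tp tc) addNr.
case: HU => -[U1 U2 U3] _; rewrite /graph_form /mass /energy /= ipr0// add0r.
by move/eqP; rewrite addr_eq0 => /eqP.
Qed.

Lemma Lsq_L2 u : Lsq area u -> L2 Omega u.
Proof.
move=> [mu uoo]; apply/LsqP; split.
  by apply/(measurable_restrictT _ mOmega); exact: measurable_funTS.
apply: le_lt_trans uoo; apply: ge0_le_integral => //.
- by move=> x _; rewrite lee_fin sqr_ge0.
- apply/measurable_EFinP/measurable_funX.
  by apply/(measurable_restrictT _ mOmega); exact: measurable_funTS.
- by apply/measurable_EFinP/measurable_funX.
- move=> x _; rewrite lee_fin patchE; case: ifP => // _.
  by rewrite expr0n sqr_ge0.
Qed.

Lemma graph_form_EFin U : Lsq3 U -> ((graph_form U U)%:E =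
  \int[area]_x (U.1 x ^+ 2 + U.2.1 x ^+ 2 + U.2.2 x ^+ 2)%:E)%E.
Proof.
move=> [L1 L2 L3].
have sq (f : plane -> R) : Lsq area f -> measurable_fun setT (fun x => (f x ^+ 2)%:E).
  by move=> [mf _]; apply/measurable_EFinP/measurable_funX.
have sq0 (f : plane -> R) x : (0 <= (f x ^+ 2)%:E)%E by rewrite lee_fin sqr_ge0.
rewrite /graph_form /mass /energy EFinD EFinD (ip_EFin L1) (ip_EFin L2) (ip_EFin L3) addeA.
rewrite -ge0_integralD//; [|exact: sq|exact: sq].
rewrite -ge0_integralD//; [|exact: emeasurable_funD (sq _ L1) (sq _ L2)|exact: sq].
by move=> x _; rewrite adde_ge0.
Qed.

Lemma form_space_H10 U : form_space Omega U -> H10 Omega U.1.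
Proof.
move=> HU; have [[U1 U2 U3] approx] := HU.
exists U.2.1, U.2.2; split; [exact: Lsq_L2|exact: Lsq_L2|exact: Lsq_L2| |].
  move=> phi tp; have tp1 := test_d1 tp; have tp2 := test_d2 tp.
  rewrite !ip_restrict//; split; [exact: form_space_ibp1|exact: form_space_ibp2].
move=> e e0; have [phi tp h] := approx e e0; exists phi => //.
move: h; rewrite -lte_fin; apply: le_lt_trans.
have LX := subspaceB Lsq3_subspace HU.1 (jet_Lsq3 tp).
rewrite -/(graph_form _ _) (graph_form_EFin LX) integral_mkcond.
case: LX => [[m1 _] [m2 _] [m3 _]]; apply: ge0_le_integral => //.
- by move=> x _; rewrite patchE; case: ifP => // _; rewrite lee_fin !addr_ge0 ?sqr_ge0.
- apply/(measurable_restrictT _ mOmega)/measurable_EFinP/measurable_funTS.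
  apply: measurable_funD; [apply: measurable_funD|]; apply: measurable_funX;
    [exact: m1|exact: m2|exact: m3].
- apply/measurable_EFinP; apply: measurable_funD; [apply: measurable_funD|];
    apply: measurable_funX; [exact: m1|exact: m2|exact: m3].
- move=> x _; rewrite patchE; case: ifP => _; first exact: lexx.
  by rewrite lee_fin !addr_ge0 ?sqr_ge0.
Qed.

(** Testing the weak equation with jets and integrating by parts once gives the
    equation in the sense of distributions. *)
Lemma form_space_eigen U lam : form_space Omega U ->
  (forall W, form_space Omega W -> energy U W = lam * mass U W) ->
  dirichlet_laplacian Omega U.1 (fun x => lam * U.1 x).
Proof.
move=> HU eigen; have [[U1 U2 U3] _] := HU.
split; first exact: form_space_H10.
  by apply: Lsq_L2; exact: (subspaceZ lam (@Lsq_subspace _ _ R area) U1).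
move=> phi tp; have tp1 := test_d1 tp; have tp2 := test_d2 tp.
have L11 := test_Lsq (test_d1 tp1); have L22 := test_Lsq (test_d2 tp2).
transitivity (- (ip area U.1 (d1 (d1 phi)) + ip area U.1 (d2 (d2 phi)))).
  rewrite -(ipDr U1 L11 L22); congr (- _).
  rewrite /ip /Rintegral integral_vanish// => x ox.
  by rewrite /laplacian (test_out (test_d1 tp1) ox) (test_out (test_d2 tp2) ox) addr0 mulr0.
have e := congr2 +%R (form_space_ibp1 HU tp1) (form_space_ibp2 HU tp2).
transitivity (energy U (jet phi)).
  by apply: etrans (congr1 -%R e) _; rewrite -opprD opprK.
rewrite (eigen _ (form_space_jet tp)).
have tpL := test_Lsq tp; have sL := @Lsq_subspace _ _ R area.
transitivity (ip area (lam *: U.1) phi); last by rewrite -ip_restrict.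
by rewrite (formZl sL (@ip_form _ _ R area)).
Qed.

Lemma graph_form_mass u U : Lsq3 U -> graph_form U (u, (0, 0)) = ip area U.1 u.
Proof.
by move=> [L1 L2 L3]; rewrite /graph_form /energy /mass (ipr0 L2) (ipr0 L3) !addr0.
Qed.

(** If [S = \sum_i a i *: psi i] vanishes almost everywhere on [Omega], then
    [(S.1, (0, 0))] is orthogonal to every jet, since test functions vanish off
    [Omega]. Hence it is orthogonal to [psi j], and the product is [a j]. *)
Lemma form_space_lin_indep n (psi : 'I_n -> V) :
  (forall i, form_space Omega (psi i)) ->
  (forall i j, mass (psi i) (psi j) = (i == j)%:R) ->
  lin_indep Omega (fun i => (psi i).1).
Proof.
move=> Hpsi orth a ae0 j.
pose S := \sum_i a i *: psi i.
have HS : form_space Omega S by apply: subspace_sum => //; exact: form_space_subspace.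
have [[S1 _ _] _] := HS.
pose W : V := (S.1, (0, 0)).
have LW : Lsq3 W by split=> //; exact: Lsq0.
have SE x : S.1 x = \sum_(i < n) a i * (psi i).1 x.
  rewrite /S; elim/big_rec2 : _ => //= i y1 y2 _ <-.
  by rewrite fctE.
have z : graph_form (psi j) W = 0.
  apply: (form_space_annihilator LW) (Hpsi j) => phi tp.
  have [p1 p2 p3] := jet_Lsq3 tp.
  rewrite (graph_form_mass _ (jet_Lsq3 tp)).
  have S1E : S.1 = fun x => \sum_(i < n) a i * (psi i).1 x by apply/funext.
  apply: (@ip_ae0 _ _ R area Omega phi S.1 p1 S1); last by rewrite S1E.
  by move=> x; exact: test_out.
have [[p1 p2 p3] _] := Hpsi j.
move: z; rewrite (graph_form_mass _ (Hpsi j).1) -/(mass (psi j) S).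
rewrite mass_form.1 (form_suml Lsq3_subspace mass_form).
- rewrite (bigD1 j)//= orth eqxx mulr1 big1 ?addr0// => i ij.
  by rewrite orth (negbTE ij) mulr0.
- by move=> i; case: (Hpsi i).
- by case: (Hpsi j).
Qed.
End Operator.

(** * Poincare inequalities on the line *)
Section OneDimensional.
Context {R : realType}.
Local Notation leb := (@lebesgue_measure R).
Variable g : R -> R.
Hypotheses (dg : forall x, derivable g x 1) (cg : continuous (derive1 g)).
Implicit Types a b c t : R.

Let E (D : set R) := (\int[leb]_(x in D) (derive1 g x ^+ 2)%:E)%E.

Let mg2 : measurable_fun setT (fun x => (derive1 g x ^+ 2)%:E).
Proof. by apply/measurable_EFinP/measurable_funX; exact: continuous_measurable_fun. Qed.

Let E_ge0 D : (0 <= E D)%E.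
Proof. by apply: integral_ge0 => x _; rewrite lee_fin sqr_ge0. Qed.

Let derivable_continuous : continuous g.
Proof. by move=> x; apply/differentiable_continuous/derivable1_diffP. Qed.

(** Integrating [2 * c * g' - c ^+ 2 <= g' ^+ 2]. With [c] the mean slope this is
    the Cauchy-Schwarz inequality; [c] is left free to choose a different slope
    on each side of a point. *)
Lemma derive_sq_ge a b c : a <= b ->
  ((2 * c * (g b - g a) - c ^+ 2 * (b - a))%:E <= E `[a, b])%E.
Proof.
move=> ab; pose G := (2 * c) *: g - (c ^+ 2) *: (@id R).
have dG x : derivable G x 1.
  by apply: derivableB; apply: derivableZ => //; exact: derivable_id.
have G' : derive1 G = fun x => 2 * c * derive1 g x - c ^+ 2.
  apply/funext => x; rewrite derive1E deriveB; last 2 first.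
  - exact: derivableZ.
  - by apply: derivableZ; exact: derivable_id.
  by rewrite deriveZ// deriveZ; [rewrite derive_id derive1E [in X in _ - X]/GRing.scale/= mulr1|exact: derivable_id].
have cG : continuous (derive1 G).
  rewrite G' => x; apply: cvgB; last exact: cvg_cst.
  by apply: cvgM; [exact: cvg_cst|exact: cg].
have -> : (2 * c * (g b - g a) - c ^+ 2 * (b - a))%:E = (G b - G a)%:E.
  by congr EFin; rewrite /G /= !fctE /GRing.scale/=; ring.
rewrite -FTC_derive//; apply: le_integral => //.
- by apply: continuous_compact_integrable; [exact: segment_compact|exact: continuous_subspaceT].
- apply: continuous_compact_integrable; first exact: segment_compact.
  apply: continuous_subspaceT => x.
  by rewrite (_ : (fun x => _) = fun x => derive1 g x * derive1 g x)//;
    apply: cvgM; exact: cg.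
- move=> x _; rewrite lee_fin G'; have := sqr_ge0 (derive1 g x - c); rewrite sqrrB; lra.
Qed.

Lemma energy_fin_num a b : E `[a, b] \is a fin_num.
Proof.
apply: integrable_fin_num => //; apply: continuous_compact_integrable; first exact: segment_compact.
apply: continuous_subspaceT => x.
by rewrite (_ : (fun x => _) = fun x => derive1 g x * derive1 g x)//;
  apply: cvgM; exact: cg.
Qed.

Lemma increment_sq_le a b : a <= b ->
  (((g b - g a) ^+ 2)%:E <= (b - a)%:E * E `[a, b])%E.
Proof.
rewrite le_eqVlt => /predU1P[->|ab].
  by rewrite subrr expr0n mule_ge0// lee_fin subrr.
have := derive_sq_ge ((g b - g a) / (b - a)) (ltW ab).
rewrite -(fineK (energy_fin_num a b)) -EFinM !lee_fin.
have ba : 0 < b - a by rewrite subr_gt0.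
have -> : 2 * ((g b - g a) / (b - a)) * (g b - g a) - ((g b - g a) / (b - a)) ^+ 2 * (b - a)
    = (g b - g a) ^+ 2 / (b - a) by field; rewrite gt_eqF.
by rewrite ler_pdivrMr// mulrC.
Qed.

(** The bound of [derive_sq_ge] with slope [c] before [t] and [- c] after [t]. A
    tent function with apex in the middle of the interval gives equality. *)
Lemma dirichlet_sq_le a b t : a <= t <= b -> g a = 0 -> g b = 0 ->
  ((4 * g t ^+ 2)%:E <= (b - a)%:E * E `[a, b])%E.
Proof.
move=> /andP[at_ tb] ga gb; have := le_trans at_ tb; rewrite le_eqVlt => /predU1P[ab|ab].
  have -> : t = a by apply/eqP; rewrite eq_le at_ ab tb.
  by rewrite ga expr0n mulr0 mule_ge0// lee_fin subr_ge0 -ab.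
pose c := 2 * g t / (b - a).
have h1 := derive_sq_ge c at_; have h2 := derive_sq_ge (- c) tb.
have EE : E `[a, b] = (E `[a, t] + E `[t, b])%E.
  have -> : E `[t, b] = E `]t, b].
    by rewrite /E integral_itv_obnd_cbnd//; exact: measurable_funTS.
  rewrite /E -ge0_integral_setU//; last 3 first.
  - exact: measurable_funTS.
  - by move=> x _; rewrite lee_fin sqr_ge0.
  - apply/disj_setPS => x [] /=; rewrite !in_itv/= => /andP[_ xt] /andP[tx _].
    by move: tx; rewrite ltNge xt.
  by rewrite -itv_bndbnd_setU ?bnd_simp.
have := leeD h1 h2; rewrite -EE -(fineK (energy_fin_num a b)) -EFinD -EFinM !lee_fin ga gb.
have ba : 0 < b - a by rewrite subr_gt0.
have -> : 2 * c * (g t - 0) - c ^+ 2 * (t - a) +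
    (2 * - c * (0 - g t) - (- c) ^+ 2 * (b - t)) = 4 * g t ^+ 2 / (b - a).
  by rewrite /c; field; rewrite gt_eqF.
by rewrite ler_pdivrMr// [fine _ * _]mulrC.
Qed.

(** The pointwise bound of [dirichlet_sq_le], integrated over each of the two
    intervals. *)
Lemma slice_poincare a b : 0 < a -> a <= b ->
  (forall x, ~ (a < `|x| < b) -> g x = 0) ->
  (\int[leb]_x (g x ^+ 2)%:E <= ((b - a) ^+ 2 / 4)%:E * E setT)%E.
Proof.
move=> a0 ab g0.
have mgg : measurable_fun setT (fun x => (g x ^+ 2)%:E).
  by apply/measurable_EFinP/measurable_funX; exact: continuous_measurable_fun.
have one u v : u <= v -> v - u = b - a -> g u = 0 -> g v = 0 ->
    (\int[leb]_(x in `[u, v]) (g x ^+ 2)%:E <= ((b - a) ^+ 2 / 4)%:E * E `[u, v])%E.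
  move=> uv uvab gu gv.
  have Efin := energy_fin_num u v.
  apply: (@le_trans _ _ (\int[leb]_(x in `[u, v]) cst ((b - a) / 4 * fine (E `[u, v]))%:E x)%E).
    apply: ge0_le_integral => //.
    - by move=> x _; rewrite lee_fin sqr_ge0.
    - exact: measurable_funTS.
    - move=> x /=; rewrite in_itv/= => xuv; have := dirichlet_sq_le xuv gu gv.
      rewrite -{1}(fineK Efin) -EFinM !lee_fin uvab; lra.
  rewrite integral_cst//= lebesgue_segment// uvab -{2}(fineK Efin) -!EFinM lee_fin.
  by rewrite le_eqVlt; apply/orP; left; apply/eqP; field.
have disj : [disjoint `[a, b]%classic & `[- b, - a]%classic].
  by apply/disj_setPS => x [] /=; rewrite !in_itv/= => /andP[xa _] /andP[_ xa']; lra.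
rewrite -(@integral_vanish _ _ _ leb (`[a, b] `|` `[- b, - a]) (fun x => (g x ^+ 2)%:E)); last first.
  move=> x xab; rewrite g0 ?expr0n// => /andP[ax xb]; apply: xab.
  have [x0|x0] := leP 0 x; [left|right]; rewrite /= in_itv/=.
    by move: ax xb; rewrite ger0_norm// => /ltW -> /ltW ->.
  by move: ax xb; rewrite ltr0_norm// => ? ?; apply/andP; split; lra.
have ga : g a = 0 by apply: g0; rewrite gtr0_norm// ltxx.
have gb : g b = 0 by apply: g0; rewrite gtr0_norm ?ltxx ?andbF// (lt_le_trans a0).
have gNa : g (- a) = 0 by apply: g0; rewrite normrN gtr0_norm// ltxx.
have gNb : g (- b) = 0 by apply: g0; rewrite normrN gtr0_norm ?ltxx ?andbF// (lt_le_trans a0).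
rewrite ge0_integral_setU//; last 2 first.
- exact: measurable_funTS.
- by move=> x _; rewrite lee_fin sqr_ge0.
apply: (@le_trans _ _ (((b - a) ^+ 2 / 4)%:E * (E `[a, b] + E `[(- b)%R, (- a)%R]))%E).
  rewrite ge0_muleDr//; apply: leeD; first exact: one.
  by apply: one => //; lra.
apply: lee_pmul => //.
- by rewrite lee_fin divr_ge0// sqr_ge0.
- exact: adde_ge0.
- rewrite /E -ge0_integral_setU//.
  + by apply: ge0_subset_integral => //; [exact: measurableU|move=> x _; rewrite lee_fin sqr_ge0].
  + exact: measurable_funTS.
  + by move=> x _; rewrite lee_fin sqr_ge0.
Qed.
End OneDimensional.

(** * Variance and slicing *)
Section Variance.
Context d {T : measurableType d} {R : realType} (mu : {measure set T -> \bar R}).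

Lemma EFin_Rintegral (D : set T) (f : T -> R) : measurable D ->
  mu.-integrable D (EFin \o f) ->
  (\int[mu]_(x in D) f x)%:E = (\int[mu]_(x in D) (f x)%:E)%E.
Proof. by move=> mD fi; rewrite /Rintegral fineK//; exact: integrable_fin_num. Qed.

Variables (D : set T) (v : R) (F : T -> R).
Hypotheses (mD : measurable D) (muD : mu D = v%:E).
Hypotheses (iF : mu.-integrable D (EFin \o F))
  (iF2 : mu.-integrable D (EFin \o (fun x => F x ^+ 2))).

Lemma integral_quadratic (a b c : R) :
  (\int[mu]_(x in D) (a * F x ^+ 2 + b * F x + c)%:E)%E =
  (a * \int[mu]_(x in D) (F x ^+ 2) + b * \int[mu]_(x in D) F x + c * v)%:E.
Proof.
have i1 : mu.-integrable D (fun x => (a * F x ^+ 2)%:E) by exact: (integrableZl mD a iF2).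
have i2 : mu.-integrable D (fun x => (b * F x)%:E) by exact: (integrableZl mD b iF).
have i3 : mu.-integrable D (fun x => c%:E).
  apply/integrableP; split; first exact: measurable_cst.
  by under eq_integral do rewrite /=; rewrite integral_cst// muD -EFinM ltry.
under eq_integral do rewrite EFinD EFinD.
rewrite integralD//; last exact: integrableD.
rewrite integralD// [X in (_ + X)%E]integral_cst// muD !EFinD.
by congr (_ + _ + _)%E; rewrite EFinM EFin_Rintegral// -integralZl.
Qed.

(** Both sides are integrals over pairs [(z, w)] in [D]: the variance, without
    division by [v], is the integral of [(F z - F w) ^+ 2]. The integration is
    carried out in [z] first, for each fixed [w]. *)
Lemma variance_le (G1 G2 : T -> \bar R) :
  (forall z, D z -> 0 <= G1 z)%E -> (forall z, D z -> 0 <= G2 z)%E ->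
  measurable_fun D G1 -> measurable_fun D G2 ->
  (forall z w, D z -> D w -> ((F z - F w) ^+ 2)%:E <= G1 z + G2 w)%E ->
  ((2 * v * \int[mu]_(x in D) (F x ^+ 2) - 2 * (\int[mu]_(x in D) F x) ^+ 2)%:E <=
   v%:E * (\int[mu]_(x in D) G1 x + \int[mu]_(x in D) G2 x))%E.
Proof.
move=> G10 G20 mG1 mG2 FG.
have v0 : 0 <= v by rewrite -lee_fin -muD.
have mF : measurable_fun D F by case/integrableP : iF => /measurable_EFinP.
set M := \int[mu]_(x in D) (F x ^+ 2); set m := \int[mu]_(x in D) F x.
set K1 := (\int[mu]_(x in D) G1 x)%E.
have quad w : (v * F w ^+ 2 + (- (2 * m)) * F w + M)%:E =
    (\int[mu]_(x in D) ((F x - F w) ^+ 2)%:E)%E.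
  transitivity (\int[mu]_(x in D) (1 * F x ^+ 2 + (- (2 * F w)) * F x + F w ^+ 2)%:E)%E.
    by rewrite integral_quadratic; congr EFin; rewrite -/M -/m; ring.
  by apply: eq_integral => x _; congr EFin; ring.
have step w : D w -> ((v * F w ^+ 2 + (- (2 * m)) * F w + M)%:E <= K1 + v%:E * G2 w)%E.
  move=> Dw; apply: (@le_trans _ _ (\int[mu]_(x in D) (G1 x + cst (G2 w) x))%E); last first.
    rewrite ge0_integralD//; first by rewrite integral_cst// muD muleC.
    by move=> x _; exact: G20.
  rewrite quad; apply: ge0_le_integral => //.
  - by move=> x _; rewrite lee_fin sqr_ge0.
  - apply/measurable_EFinP; apply: measurable_funX.
    by apply: measurable_funB => //; exact: measurable_cst.
  - exact: emeasurable_funD.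
  - by move=> x Dx; exact: FG.
have -> : (2 * v * M - 2 * m ^+ 2)%:E =
    (\int[mu]_(w in D) (v * F w ^+ 2 + (- (2 * m)) * F w + M)%:E)%E.
  by rewrite integral_quadratic; congr EFin; rewrite -/M -/m; ring.
have K10 : (0 <= K1)%E by exact: integral_ge0.
apply: (@le_trans _ _ (\int[mu]_(w in D) (cst K1 w + v%:E * G2 w))%E); last first.
  rewrite ge0_integralD//; last 2 first.
  - by move=> x Dx; rewrite mule_ge0// ?lee_fin// G20.
  - exact: emeasurable_funM.
  rewrite integral_cst// muD ge0_integralZl//.
  rewrite [(K1 * _)%E]muleC.
  by rewrite -(@ge0_muleDr _ v%:E K1 (\int[mu]_(x in D) G2 x)%E)//; exact: integral_ge0.
apply: ge0_le_integral => //.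
- by move=> w _; rewrite quad; apply: integral_ge0 => x _; rewrite lee_fin sqr_ge0.
- apply/measurable_EFinP; apply: measurable_funD => //; apply: measurable_funD.
    by apply: measurable_funM => //; exact: measurable_funX.
  exact: measurable_funM.
- by apply: emeasurable_funD => //; exact: emeasurable_funM.
Qed.
End Variance.

Section Tonelli.
Context {R : realType}.
Local Notation plane := (R * R)%type.
Local Notation leb := (@lebesgue_measure R).
Local Notation area := (leb \x leb)%E.
Variables (A B : set R) (f : plane -> \bar R).
Hypotheses (mA : measurable A) (mB : measurable B).
Hypotheses (mf : measurable_fun setT f) (f0 : forall z, (0 <= f z)%E).

Let mAB : measurable (A `*` B : set plane). Proof. exact: measurableX. Qed.
Let fAB := f \_ (A `*` B).
Let mfAB : measurable_fun setT fAB.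
Proof. by apply/(measurable_restrictT _ mAB); exact: measurable_funTS. Qed.
Let fAB0 z : (0 <= fAB z)%E.
Proof. by rewrite /fAB patchE; case: ifP. Qed.

Let inner2 x : (\int[leb]_y fAB (x, y) = ((fun x => \int[leb]_(y in B) f (x, y)) \_ A) x)%E.
Proof.
rewrite patchE; case: ifPn => [/set_mem Ax|xA].
  rewrite [RHS]integral_mkcond; apply: eq_integral => y _; rewrite /fAB !patchE.
  case: ifPn => [/set_mem[_ By]|]; first by rewrite mem_set.
  by rewrite notin_setE => h; case: ifPn => // /set_mem By; exfalso; apply: h.
rewrite integral0_eq// => y _; rewrite /fAB patchE; case: ifPn => // /set_mem[Ax _].
by move: xA; rewrite mem_set.
Qed.

Let inner1 y : (\int[leb]_x fAB (x, y) = ((fun y => \int[leb]_(x in A) f (x, y)) \_ B) y)%E.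
Proof.
rewrite patchE; case: ifPn => [/set_mem By|yB].
  rewrite [RHS]integral_mkcond; apply: eq_integral => x _; rewrite /fAB !patchE.
  case: ifPn => [/set_mem[Ax _]|]; first by rewrite mem_set.
  by rewrite notin_setE => h; case: ifPn => // /set_mem Ax; exfalso; apply: h.
rewrite integral0_eq// => x _; rewrite /fAB patchE; case: ifPn => // /set_mem[_ By].
by move: yB; rewrite mem_set.
Qed.

Lemma tonelli_rect : (\int[area]_(z in A `*` B) f z =
  \int[leb]_(x in A) \int[leb]_(y in B) f (x, y))%E.
Proof.
transitivity (\int[area]_z fAB z)%E; first by rewrite integral_mkcond.
have -> : (\int[area]_z fAB z = \int[leb]_x \int[leb]_y fAB (x, y))%E by exact: fubini_tonelli1.
rewrite [RHS]integral_mkcond.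
by apply: eq_integral => x _; exact: inner2.
Qed.

Lemma tonelli_rect_swap : (\int[area]_(z in A `*` B) f z =
  \int[leb]_(y in B) \int[leb]_(x in A) f (x, y))%E.
Proof.
transitivity (\int[area]_z fAB z)%E; first by rewrite integral_mkcond.
have -> : (\int[area]_z fAB z = \int[leb]_y \int[leb]_x fAB (x, y))%E by exact: fubini_tonelli2.
rewrite [RHS]integral_mkcond.
by apply: eq_integral => y _; exact: inner1.
Qed.

Lemma measurable_slice_integral2 :
  measurable_fun A (fun x => \int[leb]_(y in B) f (x, y))%E.
Proof.
apply/(measurable_restrictT _ mA).
rewrite (_ : _ \_ _ = fun x => \int[leb]_y fAB (x, y))%E.
  exact: (@measurable_fun_fubini_tonelli_F _ _ _ _ R leb fAB).
by apply/funext => x; rewrite inner2.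
Qed.

Lemma measurable_slice_integral1 :
  measurable_fun B (fun y => \int[leb]_(x in A) f (x, y))%E.
Proof.
apply/(measurable_restrictT _ mB).
rewrite (_ : _ \_ _ = fun y => \int[leb]_x fAB (x, y))%E.
  exact: (@measurable_fun_fubini_tonelli_G _ _ _ _ R leb fAB).
by apply/funext => y; rewrite inner1.
Qed.
End Tonelli.

(** * The Poincare-Wirtinger inequality on a square *)

(* Unification would otherwise unfold partial derivatives into limits. *)
Opaque d1 d2.
Section Cell.
Context {R : realType}.
Local Notation plane := (R * R)%type.
Local Notation leb := (@lebesgue_measure R).
Local Notation area := (leb \x leb)%E.

Lemma lebesgue_ocitv (a h : R) : 0 < h -> leb `]a, a + h]%classic = h%:E.
Proof.
move=> h0; rewrite lebesgue_measure_itv/= lte_fin ltrDl h0.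
by rewrite -EFinD; congr EFin; ring.
Qed.

Lemma lee_double (h X : R) (a : \bar R) :
  (X%:E <= h%:E * a)%E -> ((2 * X)%:E <= (2 * h)%:E * a)%E.
Proof. by move=> Xa; rewrite !EFinM -muleA; apply: lee_wpmul2l. Qed.

(** The last step of [cell_poincare], with its integrals abstracted. [P] and [Q]
    stand for the integrals of the squared partial derivatives and may be
    infinite here. *)
Lemma poincare_arith (h MM m : R) (P Q S T A B : \bar R) :
  0 < h -> (0 <= P)%E -> (0 <= Q)%E ->
  A = ((2 * h)%:E * (h%:E * P))%E -> B = ((2 * h)%:E * (h%:E * Q))%E ->
  S = (P + Q)%E -> MM%:E = T ->
  ((2 * h ^+ 2 * MM - 2 * m ^+ 2)%:E <= (h ^+ 2)%:E * (A + B))%E ->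
  (T <= ((h ^+ 2)^-1 * m ^+ 2)%:E + (h ^+ 2)%:E * S)%E.
Proof.
move=> h0 P0 Q0 -> -> -> <-; have hh : 0 < h ^+ 2 by rewrite exprn_gt0.
have S0 : (0 <= P + Q)%E by exact: adde_ge0.
rewrite !muleA -ge0_muleDr// muleA -!EFinM.
case: (P + Q)%E S0 => [r _||] //.
- rewrite -!EFinM -EFinD !lee_fin => h1; rewrite -(ler_pM2l hh).
  have -> : h ^+ 2 * ((h ^+ 2)^-1 * m ^+ 2 + h ^+ 2 * r) = m ^+ 2 + h ^+ 2 * h ^+ 2 * r.
    by field; rewrite gt_eqF.
  by move: h1; lra.
- by move=> _ _; rewrite gt0_muley ?lte_fin// addey// leey.
Qed.

Lemma measurable_sqr_continuous (f : plane -> R) : continuous f ->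
  measurable_fun setT (fun z => (f z ^+ 2)%:E).
Proof.
move=> cf; apply/measurable_EFinP/measurable_funX; exact: continuous_plane_measurable.
Qed.

Lemma sqr_EFin_ge0 (f : plane -> R) z : (0 <= (f z ^+ 2)%:E)%E.
Proof. by rewrite lee_fin sqr_ge0. Qed.

Lemma integral_sum_sqr (D : set plane) (f g : plane -> R) : measurable D ->
  continuous f -> continuous g ->
  (\int[area]_(z in D) (f z ^+ 2 + g z ^+ 2)%:E =
   \int[area]_(z in D) (f z ^+ 2)%:E + \int[area]_(z in D) (g z ^+ 2)%:E)%E.
Proof.
move=> mD cf cg; under eq_integral do rewrite EFinD.
rewrite ge0_integralD//.
- by move=> z _; exact: sqr_EFin_ge0.
- exact: measurable_funTS (measurable_sqr_continuous cf).
- by move=> z _; exact: sqr_EFin_ge0.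
- exact: measurable_funTS (measurable_sqr_continuous cg).
Qed.

Lemma increment_itv (g : R -> R) (a h x y : R) : (forall t, derivable g t 1) ->
  continuous (derive1 g) -> 0 < h -> x \in `]a, a + h] -> y \in `]a, a + h] ->
  (((g x - g y) ^+ 2)%:E <=
   h%:E * \int[leb]_(t in `]a, (a + h)%R]) (derive1 g t ^+ 2)%:E)%E.
Proof.
move=> dg cg h0; wlog xy : x y / x <= y => [hw Ix Iy|].
  have [xy|/ltW yx] := leP x y; first exact: hw.
  by rewrite -sqrrN opprB; exact: hw.
rewrite !in_itv/= => /andP[ax xa] /andP[ay ya].
rewrite -sqrrN opprB; apply: (le_trans (increment_sq_le dg cg xy)).
apply: lee_pmul => //.
- by rewrite lee_fin subr_ge0.
- by apply: integral_ge0 => t _; rewrite lee_fin sqr_ge0.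
- by rewrite lee_fin; lra.
- apply: ge0_subset_integral => //.
  + apply/measurable_funTS/measurable_EFinP/measurable_funX.
    exact: continuous_measurable_fun.
  + by move=> t _; rewrite lee_fin sqr_ge0.
  + move=> t /=; rewrite !in_itv/= => /andP[xt ty].
    by rewrite (lt_le_trans ax xt) (le_trans ty ya).
Qed.

Variables (phi : plane -> R) (M a c h : R).
Hypotheses (Cphi : Ck 1 phi) (bphi : boxed M phi) (h0 : 0 < h).
Let I : set R := `]a, a + h].
Let J : set R := `]c, c + h].
Let D : set plane := I `*` J.
Let mD : measurable D. Proof. by apply: measurableX; exact: measurable_itv. Qed.

Let cphi : continuous phi. Proof. by case: Cphi. Qed.
Let c1 : continuous (d1 phi). Proof. by case: Cphi => _ [_ _ []]. Qed.
Let c2 : continuous (d2 phi). Proof. by case: Cphi => _ [_ _ _ []]. Qed.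

Let D1 z := ((d1 phi z ^+ 2)%:E : \bar R).
Let D2 z := ((d2 phi z ^+ 2)%:E : \bar R).
Let mD1 : measurable_fun setT D1. Proof. exact: measurable_sqr_continuous c1. Qed.
Let mD2 : measurable_fun setT D2. Proof. exact: measurable_sqr_continuous c2. Qed.
Let D10 z : (0 <= D1 z)%E. Proof. exact: sqr_EFin_ge0. Qed.
Let D20 z : (0 <= D2 z)%E. Proof. exact: sqr_EFin_ge0. Qed.

Let A (y : R) := (\int[leb]_(x in I) D1 (x, y))%E.
Let B (x : R) := (\int[leb]_(y in J) D2 (x, y))%E.
Let A0 y : (0 <= A y)%E. Proof. exact: integral_ge0. Qed.
Let B0 x : (0 <= B x)%E. Proof. exact: integral_ge0. Qed.
Let mA : measurable_fun setT A.
Proof. exact: (measurable_slice_integral1 (measurable_itv _) measurableT mD1 D10). Qed.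
Let mB : measurable_fun setT B.
Proof. exact: (measurable_slice_integral2 measurableT (measurable_itv _) mD2 D20). Qed.
Let mA2 : measurable_fun (setT : set plane) (fun z => A z.2).
Proof. exact: (measurableT_comp mA measurable_snd). Qed.
Let mB1 : measurable_fun (setT : set plane) (fun z => B z.1).
Proof. exact: (measurableT_comp mB measurable_fst). Qed.

Let intA : (\int[area]_(z in D) A z.2 = h%:E * \int[area]_(z in D) D1 z)%E.
Proof.
rewrite (tonelli_rect_swap (measurable_itv _) (measurable_itv _) mA2 (fun z => A0 z.2)).
rewrite (tonelli_rect_swap (measurable_itv _) (measurable_itv _) mD1 D10).
transitivity (\int[leb]_(y in J) (h%:E * A y))%E.
  apply: eq_integral => y _.
  transitivity (\int[leb]_(x in I) cst (A y) x)%E; first by [].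
  rewrite integral_cst; last exact: measurable_itv.
  by apply: (etrans (congr1 (mule (A y)) (lebesgue_ocitv a h0))); exact: muleC.
exact: (@ge0_integralZl_EFin _ _ R leb J (measurable_itv _) A
  (fun t _ => A0 t) (measurable_funTS mA) h (ltW h0)).
Qed.

Let intB : (\int[area]_(z in D) B z.1 = h%:E * \int[area]_(z in D) D2 z)%E.
Proof.
rewrite (tonelli_rect (measurable_itv _) (measurable_itv _) mB1 (fun z => B0 z.1)).
rewrite (tonelli_rect (measurable_itv _) (measurable_itv _) mD2 D20).
transitivity (\int[leb]_(x in I) (h%:E * B x))%E.
  apply: eq_integral => x _.
  transitivity (\int[leb]_(y in J) cst (B x) y)%E; first by [].
  rewrite integral_cst; last exact: measurable_itv.
  by apply: (etrans (congr1 (mule (B x)) (lebesgue_ocitv c h0))); exact: muleC.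
exact: (@ge0_integralZl_EFin _ _ R leb I (measurable_itv _) B
  (fun t _ => B0 t) (measurable_funTS mB) h (ltW h0)).
Qed.

Let areaD : area D = (h ^+ 2)%:E.
Proof.
transitivity (leb I * leb J)%E; first by apply: product_measure1E; exact: measurable_itv.
apply: (etrans (congr2 mule (lebesgue_ocitv a h0) (lebesgue_ocitv c h0))).
by rewrite -EFinM expr2.
Qed.

(** Going from [(x, y)] horizontally to [(x', y)] and then vertically to
    [(x', y')] bounds the squared increment of [phi] by integrals of its squared
    partial derivatives over one row and one column of the square. The first
    depends only on [y] and the second only on [x'], so that [variance_le]
    applies. *)
Lemma cell_poincare :
  (\int[area]_(z in D) (phi z ^+ 2)%:E <=
   ((h ^+ 2)^-1 * (\int[area]_(z in D) phi z) ^+ 2)%:E +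
   (h ^+ 2)%:E * \int[area]_(z in D) (d1 phi z ^+ 2 + d2 phi z ^+ 2)%:E)%E.
Proof.
have iphi : area.-integrable D (EFin \o phi).
  by apply: integrableS (boxed_integrable cphi bphi).
have iphi2 : area.-integrable D (EFin \o (fun z => phi z ^+ 2)).
  apply: (integrableS measurableT) => //.
  apply: (@boxed_integrable _ M (fun z => phi z ^+ 2)).
    by move=> z; rewrite (_ : (fun z => _) = fun z => phi z * phi z)//; apply: cvgM; exact: cphi.
  exact: (boxedM bphi).
have [_ [dp1 dp2 _ _]] := Cphi.
have h20 : 0 <= 2 * h by rewrite mulr_ge0// ltW.
have h20E : (0 <= (2 * h)%:E)%E by rewrite lee_fin.
pose G1 (z : plane) := ((2 * h)%:E * A z.2)%E; pose G2 (z : plane) := ((2 * h)%:E * B z.1)%E.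
have G10 z : D z -> (0 <= G1 z)%E by move=> _; exact: (mule_ge0 h20E (A0 z.2)).
have G20 z : D z -> (0 <= G2 z)%E by move=> _; exact: (mule_ge0 h20E (B0 z.1)).
have mG1 : measurable_fun D G1.
  exact: (emeasurable_funM (measurable_cst _) (measurable_funTS mA2)).
have mG2 : measurable_fun D G2.
  exact: (emeasurable_funM (measurable_cst _) (measurable_funTS mB1)).
have bound z w : D z -> D w -> (((phi z - phi w) ^+ 2)%:E <= G1 z + G2 w)%E.
  case: z w => [x y] [x' y'] [/= Ix Jy] [/= Ix' Jy'].
  have k1 : (((phi (x, y) - phi (x', y)) ^+ 2)%:E <= h%:E * A y)%E.
    have e t : d1 phi (t, y) = derive1 (fun t => phi (t, y)) t by exact: d1_section.
    have -> : A y = (\int[leb]_(t in I) (derive1 (fun t => phi (t, y)) t ^+ 2)%:E)%E.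
      by apply: eq_integral => t _; rewrite /D1 e.
    apply: (@increment_itv (fun t => phi (t, y))) => //.
      by move=> t; rewrite -derivable_section1; exact: dp1.
    rewrite (_ : derive1 _ = fun t => d1 phi (t, y)); last by apply/funext => t; rewrite e.
    exact: continuous_section1.
  have k2 : (((phi (x', y) - phi (x', y')) ^+ 2)%:E <= h%:E * B x')%E.
    have e t : d2 phi (x', t) = derive1 (fun t => phi (x', t)) t by exact: d2_section.
    have -> : B x' = (\int[leb]_(t in J) (derive1 (fun t => phi (x', t)) t ^+ 2)%:E)%E.
      by apply: eq_integral => t _; rewrite /D2 e.
    apply: (@increment_itv (fun t => phi (x', t))) => //.
      by move=> t; rewrite -derivable_section2; exact: dp2.
    rewrite (_ : derive1 _ = fun t => d2 phi (x', t)); last by apply/funext => t; rewrite e.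
    exact: continuous_section2.
  apply: (le_trans _ (leeD (lee_double k1) (lee_double k2))).
  rewrite -EFinD lee_fin.
  have := sqr_ge0 ((phi (x, y) - phi (x', y)) - (phi (x', y) - phi (x', y'))).
  move: (phi (x, y)) (phi (x', y)) (phi (x', y')) => p q r; nra.
have var := @variance_le _ _ R area D (h ^+ 2) phi mD areaD iphi iphi2 G1 G2 G10 G20 mG1 mG2 bound.
have e1 : (\int[area]_(z in D) G1 z = (2 * h)%:E * (h%:E * \int[area]_(z in D) D1 z))%E.
  exact: (etrans (@ge0_integralZl_EFin _ _ R area D mD (fun z => A z.2) (fun z _ => A0 z.2)
    (measurable_funTS mA2) _ h20) (congr1 (mule _) intA)).
have e2 : (\int[area]_(z in D) G2 z = (2 * h)%:E * (h%:E * \int[area]_(z in D) D2 z))%E.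
  exact: (etrans (@ge0_integralZl_EFin _ _ R area D mD (fun z => B z.1) (fun z _ => B0 z.1)
    (measurable_funTS mB1) _ h20) (congr1 (mule _) intB)).
have e3 := integral_sum_sqr mD c1 c2.
have e4 := @EFin_Rintegral _ _ R area D (fun z => phi z ^+ 2) mD iphi2.
have P0 : (0 <= \int[area]_(z in D) D1 z)%E by exact: integral_ge0.
have Q0 : (0 <= \int[area]_(z in D) D2 z)%E by exact: integral_ge0.
exact: (poincare_arith h0 P0 Q0 e1 e2 e3 e4 var).
Qed.
End Cell.

(** * Coercivity up to finitely many functionals *)
Section Coercive.
Context {R : realType}.
Local Notation plane := (R * R)%type.
Local Notation leb := (@lebesgue_measure R).
Local Notation area := (leb \x leb)%E.
Local Notation V := ((plane -> R) * ((plane -> R) * (plane -> R)))%type.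

Lemma cos_acute_gt0 (theta : R) : 0 < theta < pi / 2 -> 0 < cos theta.
Proof.
move=> /andP[t0 t1]; apply: cos_gt0_pihalf.
by rewrite t1 andbT (lt_trans _ t0)// oppr_lt0 divr_gt0// pi_gt0.
Qed.

(** The consecutive intervals of length [h] going down from [c]. *)
Definition slab (c h : R) (j : nat) : set R :=
  `](c - j.+1%:R * h), (c - j.+1%:R * h + h)].

Lemma slabP (c h x : R) j : 0 < h -> slab c h j x <-> j%:R * h <= c - x < j.+1%:R * h.
Proof.
move=> h0; rewrite /slab /= in_itv/= -natr1 mulrDl mul1r.
by split=> /andP[? ?]; apply/andP; split; lra.
Qed.

Lemma slab_inj (c h x : R) i j : 0 < h -> slab c h i x -> slab c h j x -> i = j.
Proof.
move=> h0 /(slabP _ _ _ h0)/andP[i1 i2] /(slabP _ _ _ h0)/andP[j1 j2].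
have := le_lt_trans i1 j2; have := le_lt_trans j1 i2.
by rewrite !ltr_pM2r// !ltr_nat !ltnS => ? ?; apply/eqP; rewrite eqn_leq; apply/andP.
Qed.

Lemma slab_cover (c h x : R) n : 0 < h -> 0 <= c - x -> c - x < n%:R * h ->
  exists j : 'I_n, slab c h j x.
Proof.
move=> h0 cx xn; have /andP[j1 j2] := truncn_itv (divr_ge0 cx (ltW h0)).
have jn : (Num.truncn ((c - x) / h) < n)%N.
  by rewrite -(ltr_nat R) (le_lt_trans j1)// ltr_pdivrMr.
exists (Ordinal jn); apply/slabP => //=.
by rewrite -ler_pdivlMr// -ltr_pdivrMr// j1.
Qed.

Section Pieces.
Variable N : nat.

(** [None] stands for the open right half-plane; the other pieces are squares of
    side [1 / 2] that tile the points with [- N / 2 < x1 <= 0] and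
    [- N / 2 < x2 <= N / 2]. *)
Definition piece (k : option ('I_N * 'I_N.*2)) : set plane :=
  if k is Some (i, j) then slab 0 2^-1 i `*` slab (N%:R * 2^-1) 2^-1 j
  else `]0, +oo[ `*` setT.

Lemma measurable_piece k : measurable (piece k).
Proof. by case: k => [[i j]|]; apply: measurableX => //; exact: measurable_itv. Qed.

Lemma trivIset_piece : trivIset setT piece.
Proof.
have h0 : 0 < 2^-1 :> R by rewrite invr_gt0.
have neg (x : R) i : slab 0 2^-1 i x -> x <= 0.
  move=> /(slabP _ _ _ h0)/andP[+ _]; rewrite sub0r => h.
  by rewrite -oppr_ge0 (le_trans _ h)// mulr_ge0// ltW.
move=> [[i j]|] [[i' j']|] _ _ [[x y] /= [[a1 a2] [b1 b2]]] //.
- by congr (Some (_, _)); apply: val_inj; [exact: slab_inj h0 a1 b1|exact: slab_inj h0 a2 b2].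
- by move: b1; rewrite /= in_itv/= andbT ltNge (neg _ _ a1).
- by move: a1; rewrite /= in_itv/= andbT ltNge (neg _ _ b1).
Qed.

Lemma integral_pieces (f : plane -> \bar R) : measurable_fun setT f ->
  (forall z, 0 <= f z)%E -> (forall z, ~ (exists k, piece k z) -> f z = 0%E) ->
  (\int[area]_z f z = \sum_k \int[area]_(z in piece k) f z)%E.
Proof.
move=> mf f0 fout.
rewrite -(@ge0_integral_bigsetU _ _ R area _ piece f) ?index_enum_uniq//.
- rewrite integral_vanish// => z zk; apply: fout => -[k kz]; apply: zk.
  by rewrite (bigD1 k)//=; left.
- exact: measurable_piece.
- exact: sub_trivIset trivIset_piece.
- exact: measurable_funTS.
Qed.

Lemma integral_pieces_le (f : plane -> \bar R) : measurable_fun setT f ->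
  (forall z, 0 <= f z)%E ->
  (\sum_k \int[area]_(z in piece k) f z <= \int[area]_z f z)%E.
Proof.
move=> mf f0.
rewrite -(@ge0_integral_bigsetU _ _ R area _ piece f) ?index_enum_uniq//.
- apply: ge0_subset_integral => //; apply: bigsetU_measurable => k _.
  exact: measurable_piece.
- exact: measurable_piece.
- exact: sub_trivIset trivIset_piece.
- exact: measurable_funTS.
Qed.
End Pieces.
Arguments piece : clear implicits.

Section Guide.
Variable theta : R.
Hypothesis theta_itv : 0 < theta < pi / 2.

Let c0 : 0 < cos theta. Proof. exact: cos_acute_gt0. Qed.
Let s0 : 0 < sin theta.
Proof. by apply: sin_gt0_pihalf. Qed.
Let t0 : 0 < tan theta. Proof. exact: divr_gt0. Qed.

Let L : R := pi / cos theta.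
Let L0 : 0 < L. Proof. by rewrite divr_gt0// pi_gt0. Qed.

Let Lwidth x : (x + pi / sin theta) * tan theta - x * tan theta = L.
Proof. by rewrite /tan /L; field; rewrite !gt_eqF. Qed.

(** On a square the constant of [cell_poincare] is [1 / 4], which is at most
    [L ^+ 2 / 4], and the square of the integral carries the factor [4]. On the right
    half-plane [slice_poincare] applies to every vertical slice. The assumptions
    on [N] let the squares cover the rest of the guide. *)
Lemma coercive_test N phi : pi / sin theta < N%:R * 2^-1 -> L < N%:R * 2^-1 ->
  1 <= L ->
  test_function (broken_guide theta) phi ->
  (\int[area]_z (phi z ^+ 2)%:E <=
    (L ^+ 2 / 4)%:E * \int[area]_z (d1 phi z ^+ 2 + d2 phi z ^+ 2)%:E +
    (4 * \sum_k (if k is Some _ then \int[area]_(z in piece N k) phi z else 0) ^+ 2)%:E)%E.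
Proof.
move=> N1 N2 L2 tp.
have Cp := test_C1 tp; have [cp [dp1 dp2 [cp1 _] [cp2 _]]] := Cp.
have [M M0 [bp bp1 bp2]] := test_box tp.
have out z : ~ broken_guide theta z -> phi z = 0 by exact: test_out.
have m1 : measurable_fun setT (fun z => (phi z ^+ 2)%:E) by exact: measurable_sqr_continuous.
have md2 : measurable_fun setT (fun z => (d2 phi z ^+ 2)%:E) by exact: measurable_sqr_continuous.
have mg : measurable_fun setT (fun z => (d1 phi z ^+ 2 + d2 phi z ^+ 2)%:E).
  by apply/measurable_EFinP; apply: measurable_funD; apply: measurable_funX; exact: continuous_plane_measurable.
have g0 z : (0 <= (d1 phi z ^+ 2 + d2 phi z ^+ 2)%:E)%E by rewrite lee_fin addr_ge0 ?sqr_ge0.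
have kap0 : 0 <= L ^+ 2 / 4 by rewrite divr_ge0// sqr_ge0.
rewrite (@integral_pieces N)//; last 2 first.
- by move=> z; rewrite lee_fin sqr_ge0.
- move=> z zk; rewrite out ?expr0n// => gz; apply: zk.
  have h0 : 0 < 2^-1 :> R by rewrite invr_gt0.
  case: z gz => x y; rewrite /broken_guide /= => /andP[g1 g2].
  have [x0|x0] := ltP 0 x; first by exists None; split=> //=; rewrite in_itv/= x0.
  have xlow : - (pi / sin theta) < x.
    have : 0 < (x + pi / sin theta) * tan theta by apply: le_lt_trans g2.
    by rewrite pmulr_lgt0//; lra.
  have ylow : `|y| < L.
    apply: (lt_le_trans g2); rewrite -(Lwidth x) lerBrDr gerDl.
    by rewrite mulr_le0_ge0// ltW.
  move: ylow; rewrite ltr_norml => /andP[y1 y2].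
  have [||i hi] := @slab_cover 0 2^-1 x N h0; [lra|lra|].
  have [||j hj] := @slab_cover (N%:R * 2^-1) 2^-1 y N.*2 h0; [lra| |].
    by rewrite -addnn natrD; lra.
  by exists (Some (i, j)).
apply: (@le_trans _ _ (\sum_k ((L ^+ 2 / 4)%:E * \int[area]_(z in piece N k) (d1 phi z ^+ 2 + d2 phi z ^+ 2)%:E +
    (4 * (if k is Some _ then \int[area]_(z in piece N k) phi z else 0) ^+ 2)%:E))%E); last first.
  rewrite big_split/= sumEFin -mulr_sumr leeD2r//.
  rewrite -ge0_sume_distrr; last by move=> k _; exact: integral_ge0.
  by apply: lee_pmul => //; [apply: sume_ge0 => k _; exact: integral_ge0|exact: integral_pieces_le].
apply: lee_sum => -[[i j]|] _; rewrite /piece.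
  apply: (le_trans (@cell_poincare R phi M _ _ 2^-1 Cp bp _)); first by rewrite invr_gt0.
  rewrite addeC; apply: leeD.
    apply: lee_pmul => //; first by apply: integral_ge0.
    rewrite lee_fin (_ : 2^-1 ^+ 2 = 4^-1 :> R); last by field.
    by have := exprn_ege1 2 L2; lra.
  rewrite lee_fin (_ : 2^-1 ^- 2 = 4 :> R); last by field.
  exact: lexx.
rewrite expr0n mulr0 adde0.
pose H : set plane := `]0, +oo[ `*` setT.
have t1 : (\int[area]_(z in H) (phi z ^+ 2)%:E <=
    (L ^+ 2 / 4)%:E * \int[area]_(z in H) (d2 phi z ^+ 2)%:E)%E.
  rewrite (tonelli_rect (measurable_itv _) measurableT m1 (sqr_EFin_ge0 _)).
  rewrite (tonelli_rect (measurable_itv _) measurableT md2 (sqr_EFin_ge0 _)).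
  have mF := measurable_slice_integral2 measurableT measurableT m1 (sqr_EFin_ge0 _).
  have mG := measurable_slice_integral2 measurableT measurableT md2 (sqr_EFin_ge0 _).
  have G0 x : (0 <= \int[leb]_(y in setT) (d2 phi (x, y) ^+ 2)%:E)%E.
    by apply: integral_ge0 => y _; exact: sqr_EFin_ge0.
  have e := @ge0_integralZl_EFin _ _ R leb `]0, +oo[ (measurable_itv _) _ (fun x _ => G0 x)
    (measurable_funTS mG) _ kap0.
  rewrite /= in e; rewrite -e {e}.
  apply: ge0_le_integral => //.
  - by move=> x _; apply: integral_ge0 => y _; exact: sqr_EFin_ge0.
  - exact: measurable_funTS mF.
  - by apply: emeasurable_funM => //; exact: measurable_funTS mG.
  - move=> x /=; rewrite in_itv/= andbT => x0.
    have e t : d2 phi (x, t) = derive1 (fun t => phi (x, t)) t by exact: d2_section.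
    have xt : 0 < x * tan theta by exact: mulr_gt0.
    have := @slice_poincare R (fun t => phi (x, t)) _ _ (x * tan theta)
      ((x + pi / sin theta) * tan theta) xt.
    rewrite Lwidth => sp; under [X in (_ * X)%E]eq_integral do rewrite e.
    apply: sp.
    + by move=> t; rewrite -derivable_section2; exact: dp2.
    + rewrite (_ : derive1 _ = fun t => d2 phi (x, t)); last by apply/funext => t; rewrite e.
      exact: continuous_section2.
    + by rewrite -subr_ge0 Lwidth ltW.
    + by move=> y hy; exact: out.
apply: (le_trans t1); apply: lee_wpmul2l; first by rewrite lee_fin.
apply: ge0_le_integral => //.
- by apply: measurableX => //; exact: measurable_itv.
- by move=> z _; exact: sqr_EFin_ge0.
- exact: measurable_funTS md2.
- exact: measurable_funTS mg.
- by move=> z _; rewrite lee_fin lerDr sqr_ge0.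
Qed.
End Guide.
End Coercive.
Arguments piece {R} N k.

Section CoerciveFormSpace.
Context {R : realType}.
Local Notation plane := (R * R)%type.
Local Notation leb := (@lebesgue_measure R).
Local Notation area := (leb \x leb)%E.
Local Notation V := ((plane -> R) * ((plane -> R) * (plane -> R)))%type.

Lemma Lsq_indic (D : set plane) : measurable D -> (area D < +oo)%E -> Lsq area \1_D.
Proof.
move=> mD Doo; split; first exact: measurable_indic.
rewrite (_ : (fun x => _) = fun x => (\1_D x)%:E); last first.
  by apply/funext => x; rewrite indicE; case: (x \in D); rewrite ?expr1n ?expr0n.
by rewrite integral_indic// setIT.
Qed.

Lemma Rintegral_ip_indic (D : set plane) (f : plane -> R) :
  \int[area]_(z in D) f z = ip area f \1_D.
Proof.
rewrite Rintegral_mkcond; apply: eq_Rintegral => z _.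
by rewrite patchE indicE; case: (z \in D); rewrite ?mulr1 ?mulr0.
Qed.

(** The half-plane contributes no functional; its index is kept, with the zero
    function, so that the functionals are indexed like the pieces. *)
Definition probe (N : nat) (k : option ('I_N * 'I_N.*2)) : plane -> R :=
  if k is Some _ then \1_(piece N k) else 0.

Lemma Lsq_probe N k : Lsq area (@probe N k).
Proof.
case: k => [[i j]|]; last exact: Lsq0.
apply: Lsq_indic; first exact: measurable_piece.
have h0 : 0 < 2^-1 :> R by rewrite invr_gt0.
rewrite [X in (X < _)%E](_ : _ =
    (leb (slab 0 2^-1 i) * leb (slab (N%:R * 2^-1) 2^-1 j))%E).
  rewrite [X in (X * _)%E]lebesgue_ocitv// [X in (_ * X)%E]lebesgue_ocitv//.
  by rewrite -EFinM ltry.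
by apply: product_measure1E; exact: measurable_itv.
Qed.

Definition ell N k (U : V) : R := ip area U.1 (@probe N k).

Lemma ellB N k (U W : V) : Lsq3 U -> Lsq3 W -> @ell N k (U - W) = ell k U - ell k W.
Proof.
move=> [U1 _ _] [W1 _ _]; exact: (formBl (@ip_form _ _ R area) U1 W1 (Lsq_probe k)).
Qed.

Lemma ell_bounded N k (U : V) : Lsq3 U ->
  @ell N k U ^+ 2 <= (\sum_k ip area (@probe N k) (probe k)) * mass U U.
Proof.
move=> [U1 _ _]; have sL := @Lsq_subspace _ _ R area.
apply: le_trans (form_CS sL (@ip_form _ _ R area) (fun w _ => ip_ge0 area w) U1 (Lsq_probe k)) _.
rewrite mulrC ler_wpM2r ?mass_ge0// (bigD1 k)//= lerDl.
by apply: sumr_ge0 => i _; exact: ip_ge0.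
Qed.

Section Guide.
Variable theta : R.
Hypothesis theta_itv : 0 < theta < pi / 2.
Let L : R := pi / cos theta.
Local Notation Omega := (broken_guide theta).
Variable N : nat.
Hypotheses (N1 : pi / sin theta < N%:R * 2^-1) (N2 : L < N%:R * 2^-1) (L1 : 1 <= L).

Lemma coercive_jet phi : test_function Omega phi ->
  mass (jet phi) (jet phi) <=
    L ^+ 2 / 4 * energy (jet phi) (jet phi) + 4 * \sum_k @ell N k (jet phi) ^+ 2.
Proof.
move=> tp; have [p1 p2 p3] := jet_Lsq3 tp.
have [_ [_ _ [c1 _] [c2 _]]] := test_C1 tp.
rewrite -lee_fin EFinD EFinM (ip_EFin p1).
have -> : (energy (jet phi) (jet phi))%:E =
    (\int[area]_z (d1 phi z ^+ 2 + d2 phi z ^+ 2)%:E)%E.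
  rewrite (integral_sum_sqr measurableT c1 c2) /energy EFinD.
  exact: (congr2 (@adde R) (ip_EFin p2) (ip_EFin p3)).
apply: (le_trans (coercive_test theta_itv N1 N2 L1 tp)).
rewrite leeD2l// lee_fin ler_wpM2l//; apply: ler_sum => -[[i j]|] _ //=.
  by rewrite Rintegral_ip_indic.
by rewrite expr0n sqr_ge0.
Qed.

(** Both sides of [coercive_jet] are continuous in the graph norm. *)
Lemma coercive_form_space U : form_space Omega U ->
  mass U U <= L ^+ 2 / 4 * energy U U + 4 * \sum_k @ell N k U ^+ 2.
Proof.
move=> [LU approx]; have sL := @Lsq3_subspace R.
have /choice[phi hphi] n : exists phi, test_function Omega phi /\
    mass (U - jet phi) (U - jet phi) + energy (U - jet phi) (U - jet phi) < n.+1%:R^-1.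
  by have [|phi tp h] := approx n.+1%:R^-1; [rewrite invr_gt0|exists phi].
have tp n : test_function Omega (phi n) by case: (hphi n).
have Lp n : Lsq3 (jet (phi n)) by exact: jet_Lsq3 (tp n).
have neg f W X : form_on (@Lsq3 R) f -> Lsq3 W -> Lsq3 X -> f (W - X) (W - X) = f (X - W) (X - W).
  move=> fF LW LX; rewrite -(opprB X W) -scaleN1r.
  have LXW := subspaceB sL LX LW.
  rewrite (formZl sL fF)//; last exact: subspaceZ.
  by rewrite fF.1 (formZl sL fF)// mulrA mulrNN !mulr1 mul1r.
have small f : form_on (@Lsq3 R) f -> (forall X, 0 <= f X X) ->
    (forall X, f X X <= graph_form X X) ->
    (fun n => f (jet (phi n) - U) (jet (phi n) - U)) @ \oo --> 0.
  move=> fF f0 fg; apply: (@squeeze_cvgr _ _ _ _ (cst 0) (fun n => n.+1%:R^-1)).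
  - near=> n; rewrite /= f0/= -(neg _ _ _ fF LU (Lp n)).
    by apply: (le_trans (fg _)); apply/ltW; case: (hphi n).
  - exact: cvg_cst.
  - exact: cvg_harmonic.
have mc := small mass (@mass_form R) (@mass_ge0 R) (fun X => ltac:(by rewrite lerDl energy_ge0)).
have ec := small energy (@energy_form R) (@energy_ge0 R) (fun X => ltac:(by rewrite lerDr mass_ge0)).
have mlim := form_cvg sL (@mass_form R) (fun X _ => mass_ge0 X) Lp LU mc.
have elim_ := form_cvg sL (@energy_form R) (fun X _ => energy_ge0 X) Lp LU ec.
have llim k : (fun n => @ell N k (jet (phi n))) @ \oo --> ell k U.
  pose W : V := (probe k, (0, 0)).
  have LW : Lsq3 W by split; [exact: Lsq_probe|exact: Lsq0|exact: Lsq0].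
  exact: (form_cvgl sL (@mass_form R) (fun X _ => mass_ge0 X) Lp LU LW mc).
have slim : (fun n => \sum_k @ell N k (jet (phi n)) ^+ 2) @ \oo --> \sum_k @ell N k U ^+ 2.
  apply: (@cvg_big R _ +%R 0 xpredT (@add_continuous R)) => k _.
  by rewrite expr2; under eq_fun do rewrite expr2; exact: cvgM.
have rlim : (fun n => L ^+ 2 / 4 * energy (jet (phi n)) (jet (phi n)) +
    4 * \sum_k @ell N k (jet (phi n)) ^+ 2) @ \oo -->
    L ^+ 2 / 4 * energy U U + 4 * \sum_k @ell N k U ^+ 2.
  by apply: cvgD; [exact: cvgMl_tmp elim_|exact: cvgMl_tmp slim].
rewrite -(cvg_lim (@Rhausdorff R) mlim) -(cvg_lim (@Rhausdorff R) rlim).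
apply: ler_lim; [by apply/cvg_ex; exists (mass U U)|by apply/cvg_ex; eexists; exact: rlim|].
by near=> n; exact: coercive_jet.
Unshelve. all: end_near. Qed.
End Guide.
End CoerciveFormSpace.
Arguments probe {R} N k.
Arguments ell {R} N k U.

(** * Smooth bumps on the line *)
Section FlatExponential.
Context {R : realType}.
Variable eps : R.
Hypothesis eps0 : 0 < eps.

(** The function [exp (- eps / s) / s ^+ n], extended by [0] to [s <= 0]: up to
    linear combinations this family is closed under differentiation. *)
Definition flat (n : nat) (s : R) : R :=
  if 0 < s then s^-1 ^+ n * expR (- (eps * s^-1)) else 0.

Lemma flat_gt0 n s : 0 < s -> 0 < flat n s.
Proof. by move=> s0; rewrite /flat s0 mulr_gt0 ?expR_gt0// exprn_gt0// invr_gt0. Qed.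

Lemma flat_le0 n s : s <= 0 -> flat n s = 0.
Proof. by move=> s0; rewrite /flat ltNge s0. Qed.

Lemma flatS n s : flat n s = s * flat n.+1 s.
Proof.
have [s0|s0] := ltP 0 s; last by rewrite !flat_le0// mulr0.
by rewrite /flat s0 exprS !mulrA divff ?mul1r// gt_eqF.
Qed.

(** A term of the exponential series gives
    [expR (eps / s) >= (eps / s) ^+ n.+2 / (n.+2)`!]. The quadratic decay makes
    the derivative at [0] vanish. *)
Lemma flat_bound n : exists2 C, 0 < C & forall s, 0 <= flat n s <= C * s ^+ 2.
Proof.
pose f : R := (n.+2)`!%:R; have f0 : 0 < f by rewrite ltr0n fact_gt0.
exists (f / eps ^+ n.+2) => [|s]; first by rewrite divr_gt0// exprn_gt0.
have [s0|s0] := ltP 0 s; last first.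
  by rewrite flat_le0// lexx mulr_ge0 ?sqr_ge0// divr_ge0 ?exprn_ge0// ltW.
rewrite ltW ?flat_gt0//= /flat s0 expRN.
have h : (eps * s^-1) ^+ n.+2 / f <= expR (eps * s^-1).
  apply: le_trans (expR_ge1Dxn n.+1 _); first by rewrite lerDr ler01.
  by rewrite mulr_ge0 ?invr_ge0// ltW.
have e0 : 0 < (eps * s^-1) ^+ n.+2 / f.
  by rewrite divr_gt0// exprn_gt0// mulr_gt0// invr_gt0.
apply: (@le_trans _ _ (s^-1 ^+ n * ((eps * s^-1) ^+ n.+2 / f)^-1)).
  by rewrite ler_wpM2l ?exprn_ge0 ?invr_ge0 ?(ltW s0)// lef_pV2// posrE expR_gt0.
rewrite le_eqVlt; apply/orP; left; apply/eqP.
rewrite invf_div exprMn !exprVn !exprS; field.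
by rewrite !gt_eqF ?exprn_gt0.
Qed.

Lemma is_derive_flat n (s : R) :
  is_derive s (1 : R) (flat n) (- n%:R * flat n.+1 s + eps * flat n.+2 s).
Proof.
have [s0|s0|<-] := ltgtP 0 s.
- apply: (@near_eq_is_derive R R R (fun s => s^-1 ^+ n * expR (- (eps * s^-1)))).
    near=> t; rewrite /flat; case: ifPn => //; rewrite -leNgt => t0.
    exfalso; have : 0 < t by near: t; exact: lt_nbhsr.
    by rewrite ltNge t0.
  have s0' : s != 0 by rewrite gt_eqF.
  have dV : is_derive s 1 (fun s : R => s^-1) (- s ^- 2).
    by apply: is_derive_eq (is_deriveV s0' (is_derive_id s 1)) _; rewrite /GRing.scale/= mulr1.
  have dE : is_derive s 1 (fun s => expR (- (eps * s^-1)))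
      (expR (- (eps * s^-1)) * (eps * s ^- 2)).
    apply: (@is_derive1_comp R expR (fun s => - (eps * s^-1))).
    apply: is_derive_eq (is_deriveN (is_deriveZ eps dV)) _.
    by rewrite /GRing.scale/= mulrN opprK.
  case: n => [|n].
    rewrite (_ : (fun s => _) = fun s => expR (- (eps * s^-1))); last first.
      by apply/funext => t; rewrite expr0 mul1r.
    apply: is_derive_eq dE _; rewrite oppr0 mul0r add0r /flat s0 exprVn.
    by rewrite mulrC -mulrA.
  have dX := is_deriveX n.+1 dV; rewrite exprfctE in dX.
  apply: is_derive_eq (is_deriveM dX dE) _.
  rewrite /flat s0 /GRing.scale/= -mulr_natl !exprS !exprVn expr0; field.
  by rewrite s0' expf_neq0.
- rewrite !flat_le0 ?ltW// !mulr0 addr0.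
  apply: (@near_eq_is_derive R R R (cst 0)).
  near=> t; rewrite flat_le0//; apply/ltW; near: t; exact: lt_nbhsl.
- rewrite !flat_le0// !mulr0 addr0.
  have [C C0 hC] := flat_bound n.
  have lim0 : (fun h => h^-1 *: ((flat n \o shift 0) (h *: (1 : R)) - flat n 0)) @ 0^' --> (0 : R).
    apply/cvgr0Pnorm_le => e e0; near=> h.
    have h0 : h != 0 by near: h; exact: nbhs_dnbhs_neq.
    have he : `|h| <= e / C.
      near: h; apply: dnbhs0_le; exact: divr_gt0.
    rewrite /= /GRing.scale/= mulr1 addr0 (flat_le0 _ (lexx 0)) subr0 normrM normfV.
    rewrite ler_pdivrMl ?normr_gt0//; have /andP[f1 f2] := hC h.
    rewrite ger0_norm//; apply: (le_trans f2).
    rewrite -real_normK ?num_real// expr2 mulrA mulrC ler_wpM2l//.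
    by rewrite mulrC -ler_pdivlMr.
  by apply: DeriveDef; [apply/cvg_ex; exists 0|exact/cvg_lim].
Unshelve. all: end_near. Qed.
End FlatExponential.

Section Bump.
Context {R : realType}.
Local Notation leb := (@lebesgue_measure R).
Variables (a rho : R).
Hypothesis rho0 : 0 < rho.

(* As [eps] tends to [0] the bump tends to the parabola [S], whose Rayleigh
   quotient is [5 / 2 / rho ^+ 2]. This value of [eps] makes the bounds below
   give the quotient [3 / rho ^+ 2]. *)
Let eps : R := rho ^+ 2 / 15.
Let eps0 : 0 < eps. Proof. by rewrite divr_gt0// exprn_gt0. Qed.

Let S : {poly R} := (rho ^+ 2)%:P - ('X - a%:P) ^+ 2.
Let SE t : S.[t] = rho ^+ 2 - (t - a) ^+ 2.
Proof. by rewrite /S !hornerE. Qed.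
Let S'E t : S^`().[t] = - (2 * (t - a)).
Proof. by rewrite /S derivB derivC deriv_exp derivXsubC !hornerE/= -mulr_natl; ring. Qed.

(** The derivative of order [k] of [S * exp (- eps / S)] has the form
    [bump_poly k / S ^+ k.*2 * exp (- eps / S)]. Differentiating once more and
    reducing to the denominator [S ^+ k.+1.*2] gives the recursion. *)
Fixpoint bump_poly (k : nat) : {poly R} :=
  if k is j.+1 then
    (bump_poly j)^`() * S ^+ 2
    + bump_poly j * S^`() * (eps%:P - (j.*2)%:R%:P * S)
  else S.

Definition bump (k : nat) (t : R) : R := (bump_poly k).[t] * flat eps k.*2 S.[t].

Lemma is_derive_bump k (t : R) : is_derive t (1 : R) (bump k) (bump k.+1 t).
Proof.
have d1 := is_derive1_comp (is_derive_flat eps0 k.*2 S.[t]) (is_derive_poly S t).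
apply: is_derive_eq (is_deriveM (is_derive_poly (bump_poly k) t) d1) _.
rewrite /bump doubleS /= !hornerE /GRing.scale/=.
rewrite (flatS _ k.*2) (flatS _ k.*2.+1); ring.
Qed.

Lemma bump_support k t : bump k t != 0 -> `|t - a| < rho.
Proof.
apply: contraNT; rewrite -leNgt => h; rewrite /bump flat_le0 ?mulr0// SE subr_le0.
by rewrite -[leRHS]real_normK ?num_real// ler_pXn2r// nnegrE ltW.
Qed.

Let polynomial_FTC (p : {poly R}) u v : u <= v ->
  (\int[leb]_(t in `[u, v]) (p^`().[t])%:E = (p.[v] - p.[u])%:E)%E.
Proof.
move=> uv; rewrite -FTC_derive//.
- by apply: eq_integral => t _; rewrite -derivE.
- by rewrite -derivE; exact: continuous_horner.
Qed.

Let lo := a - rho.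
Let hi := a + rho.
Let lohi : lo <= hi. Proof. by rewrite /lo /hi; have := rho0; lra. Qed.
Let U : {poly R} := 'X - a%:P.
Let UE t : U.[t] = t - a. Proof. by rewrite /U !hornerE. Qed.

Let mono c n t : (c%:P * U ^+ n).[t] = c * (t - a) ^+ n.
Proof. by rewrite hornerM hornerC horner_exp UE. Qed.
Let mono' c n t : (c%:P * U ^+ n)^`().[t] = c * (n%:R * (t - a) ^+ n.-1).
Proof.
rewrite derivM derivC mul0r add0r deriv_exp derivXsubC mul1r.
by rewrite hornerM hornerC hornerMn horner_exp UE mulr_natl.
Qed.

Let upper_int : (\int[leb]_(t in `[lo, hi]) ((4 * (t - a) ^+ 2)%:E) = (8 / 3 * rho ^+ 3)%:E)%E.
Proof.
pose Q := (4 / 3)%:P * U ^+ 3.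
have QE t : Q^`().[t] = 4 * (t - a) ^+ 2.
  by rewrite /Q mono'; field.
transitivity (\int[leb]_(t in `[lo, hi]) (Q^`().[t])%:E)%E.
  by apply: eq_integral => t _; rewrite QE.
rewrite polynomial_FTC//; congr EFin.
by rewrite /Q !mono /lo /hi; field.
Qed.

Let quad (p : {poly R}) c t : (p ^+ 2 - c%:P * p).[t] = p.[t] ^+ 2 - c * p.[t].
Proof. by rewrite hornerD hornerN horner_exp hornerM hornerC. Qed.

Let bump1E (p r : {poly R}) c t :
  (r * p ^+ 2 + p * r * (c%:P - 0%:R%:P * p)).[t] =
  r.[t] * p.[t] ^+ 2 + p.[t] * r.[t] * c.
Proof.
by rewrite polyC0 mul0r subr0 hornerD !hornerM hornerC expr2.
Qed.

Let lower_int : (\int[leb]_(t in `[lo, hi]) ((S.[t] ^+ 2 - 2 * eps * S.[t])%:E) =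
  (8 / 9 * rho ^+ 5)%:E)%E.
Proof.
pose Q := (rho ^+ 4 - 2 * eps * rho ^+ 2)%:P * U ^+ 1
  + ((2 * eps - 2 * rho ^+ 2) / 3)%:P * U ^+ 3 + (5^-1)%:P * U ^+ 5.
have QE t : Q^`().[t] = S.[t] ^+ 2 - 2 * eps * S.[t].
  by rewrite SE /Q !derivD !hornerD !mono' /=; field.
transitivity (\int[leb]_(t in `[lo, hi]) (Q^`().[t])%:E)%E.
  by apply: eq_integral => t _; rewrite QE.
rewrite polynomial_FTC//; congr EFin.
by rewrite /Q !hornerD !mono /lo /hi /eps; field.
Qed.

Lemma bump_continuous k : continuous (bump k).
Proof.
move=> t; apply/differentiable_continuous/derivable1_diffP.
by case: (is_derive_bump k t).
Qed.

Let sqr_integrable k : leb.-integrable `[lo, hi] (fun t => (bump k t ^+ 2)%:E).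
Proof.
apply: continuous_compact_integrable; first exact: segment_compact.
apply: continuous_subspaceT => x.
by rewrite (_ : (fun x => _) = fun x => bump k x * bump k x)//;
  apply: cvgM; exact: bump_continuous.
Qed.

Let integral_bump k :
  (\int[leb]_t (bump k t ^+ 2)%:E = \int[leb]_(t in `[lo, hi]) (bump k t ^+ 2)%:E)%E.
Proof.
rewrite [RHS]integral_vanish// => t; rewrite /= in_itv/= => ht.
suff -> : bump k t = 0 by rewrite expr0n.
apply/eqP; apply: contra_notT ht => /bump_support; rewrite ltr_norml => /andP[? ?].
by apply/andP; split; rewrite /lo /hi; lra.
Qed.

(** [S ^+ 2 * exp (- 2 * eps / S) >= S ^+ 2 - 2 * eps * S], a polynomial. *)
Lemma bump_mass_lower : ((8 / 9 * rho ^+ 5)%:E <= \int[leb]_t (bump 0 t ^+ 2)%:E)%E.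
Proof.
rewrite integral_bump -lower_int; apply: le_integral => //.
  have c : continuous (horner (S ^+ 2 - (2 * eps)%:P * S)) by exact: continuous_horner.
  rewrite (_ : (fun t => _) = EFin \o horner (S ^+ 2 - (2 * eps)%:P * S)).
    by apply: continuous_compact_integrable; [exact: segment_compact|exact: continuous_subspaceT].
  by apply/funext => t; congr EFin; rewrite -quad.
move=> t; rewrite inE /= in_itv/= => /andP[t1 t2]; rewrite lee_fin /bump /=.
have [s0|s0] := ltP 0 S.[t]; last first.
  have tr : `|t - a| <= rho.
    by move: t1 t2; rewrite ler_norml /lo /hi => t1 t2; apply/andP; split; lra.
  have -> : S.[t] = 0.
    apply/eqP; rewrite eq_le s0 SE subr_ge0 -[leLHS]real_normK ?num_real//.
    by rewrite ler_pXn2r ?nnegrE ?normr_ge0 ?(ltW rho0).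
  by rewrite !mul0r !mulr0 expr0n subr0.
rewrite /flat s0 expr0 mul1r exprMn.
set y := expR _.
have h : 1 - 2 * (eps * S.[t]^-1) <= y ^+ 2.
  rewrite /y expr2 -expRD; apply: le_trans (expR_ge1Dx _); lra.
apply: (@le_trans _ _ (S.[t] ^+ 2 * (1 - 2 * (eps * S.[t]^-1)))).
  by rewrite le_eqVlt; apply/orP; left; apply/eqP; field; rewrite gt_eqF.
by rewrite ler_wpM2l// sqr_ge0.
Qed.

(** With [x = eps / S] the derivative is [S' * (1 + x) * exp (- x)], of modulus
    at most that of [S']. *)
Lemma bump_energy_upper : (\int[leb]_t (bump 1 t ^+ 2)%:E <= (8 / 3 * rho ^+ 3)%:E)%E.
Proof.
rewrite integral_bump -upper_int; apply: ge0_le_integral => //.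
- by move=> t _; rewrite lee_fin sqr_ge0.
- by case/integrableP: (sqr_integrable 1).
- by apply/measurable_EFinP/measurable_funTS; apply: continuous_measurable_fun => t;
    apply: cvgM; [exact: cvg_cst|];
    apply: (@cvg_comp _ _ _ (fun t => t - a) (fun t => t ^+ 2) _ (nbhs (t - a)));
    [apply: cvgB => //; exact: cvg_cst|exact: exprn_continuous].
- move=> t _; rewrite lee_fin /bump /=.
  have [s0|s0] := ltP 0 S.[t]; last by rewrite flat_le0// mulr0 expr0n mulr_ge0// sqr_ge0.
  pose x := eps * S.[t]^-1.
  have x0 : 0 <= x by rewrite /x mulr_ge0 ?invr_ge0 ?(ltW eps0) ?(ltW s0).
  have -> : (S^`() * S ^+ 2 + S * S^`() * (eps%:P - 0%:R%:P * S)).[t] * flat eps 2 S.[t]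
      = - (2 * (t - a)) * ((1 + x) * expR (- x)).
    rewrite bump1E S'E /flat s0 /x exprVn; field; exact/lt0r_neq0.
  rewrite exprMn sqrrN (_ : (2 * (t - a)) ^+ 2 = 4 * (t - a) ^+ 2); last by ring.
  have y0 : 0 <= (1 + x) * expR (- x) by rewrite mulr_ge0 ?expR_ge0// addr_ge0.
  have y1 : (1 + x) * expR (- x) <= 1.
    by rewrite expRN ler_pdivrMr ?expR_gt0// mul1r expR_ge1Dx.
  apply: ler_piMr; first by rewrite mulr_ge0// sqr_ge0.
  exact: exprn_ile1.
Qed.

Lemma bump_rayleigh : (\int[leb]_t (bump 1 t ^+ 2)%:E <=
  (3 / rho ^+ 2)%:E * \int[leb]_t (bump 0 t ^+ 2)%:E)%E.
Proof.
apply: (le_trans bump_energy_upper).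
apply: (@le_trans _ _ ((3 / rho ^+ 2)%:E * (8 / 9 * rho ^+ 5)%:E)%E).
  rewrite -EFinM lee_fin le_eqVlt; apply/orP; left; apply/eqP; field; exact/lt0r_neq0.
by apply: lee_wpmul2l bump_mass_lower; rewrite lee_fin divr_ge0// sqr_ge0.
Qed.

Lemma bump_mass_gt0 : (0 < \int[leb]_t (bump 0 t ^+ 2)%:E)%E.
Proof.
by apply: lt_le_trans bump_mass_lower; rewrite lte_fin mulr_gt0// exprn_gt0.
Qed.
End Bump.

(** * Product bumps in the plane *)
Section Trial.
Context {R : realType}.
Local Notation plane := (R * R)%type.
Local Notation leb := (@lebesgue_measure R).
Local Notation area := (leb \x leb)%E.

Lemma integral_product_sqr (f g : R -> R) : continuous f -> continuous g ->
  (\int[area]_z ((f z.1 * g z.2) ^+ 2)%:E =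
   \int[leb]_x (f x ^+ 2)%:E * \int[leb]_y (g y ^+ 2)%:E)%E.
Proof.
move=> cf cg.
have mf2 : measurable_fun setT (fun x => (f x ^+ 2)%:E).
  by apply/measurable_EFinP/measurable_funX; exact: continuous_measurable_fun.
have mg2 : measurable_fun setT (fun x => (g x ^+ 2)%:E).
  by apply/measurable_EFinP/measurable_funX; exact: continuous_measurable_fun.
have G0 : (0 <= \int[leb]_y (g y ^+ 2)%:E)%E.
  by apply: integral_ge0 => y _; rewrite lee_fin sqr_ge0.
pose h (z : plane) : \bar R := ((f z.1 * g z.2) ^+ 2)%:E.
have mh : measurable_fun setT h.
  apply/measurable_EFinP/measurable_funX; apply: measurable_funM.
    exact: (measurableT_comp (continuous_measurable_fun cf) measurable_fst).
  exact: (measurableT_comp (continuous_measurable_fun cg) measurable_snd).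
have h0 z : (0 <= h z)%E by rewrite lee_fin sqr_ge0.
transitivity (\int[area]_(z in (setT `*` setT)) h z)%E; first by rewrite setXTT.
rewrite (tonelli_rect measurableT measurableT mh h0).
transitivity (\int[leb]_x ((f x ^+ 2)%:E * \int[leb]_y (g y ^+ 2)%:E))%E; last first.
  by rewrite ge0_integralZr// => x _; rewrite lee_fin sqr_ge0.
apply: eq_integral => x _.
rewrite -ge0_integralZl_EFin ?sqr_ge0//; last by move=> y _; rewrite lee_fin sqr_ge0.
by apply: eq_integral => y _; rewrite -EFinM /h /= exprMn.
Qed.

Lemma lee_rayleigh (k1 k2 : R) (A0 A1 B0 B1 : \bar R) :
  0 <= k1 -> 0 <= k2 -> (0 <= A0)%E -> (0 <= B0)%E ->
  (A1 <= k1%:E * A0)%E -> (B1 <= k2%:E * B0)%E ->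
  (A1 * B0 + A0 * B1 <= (k1 + k2)%:E * (A0 * B0))%E.
Proof.
move=> k10 k20 A00 B00 A10 B10; rewrite EFinD ge0_muleDl ?lee_fin//.
apply: leeD; first by rewrite muleA; exact: lee_wpmul2r.
by rewrite muleCA; exact: lee_wpmul2l.
Qed.

Variables (a r1 r2 : R).
Hypotheses (r10 : 0 < r1) (r20 : 0 < r2).

(** The indices count derivatives, so that a partial derivative shifts one of
    them. *)
Definition trial (i j : nat) : plane -> R :=
  fun z => bump a r1 i z.1 * bump 0 r2 j z.2.

Lemma derivable_trial1 i j z : derivable (trial i j) z (1, 0) /\
  d1 (trial i j) z = trial i.+1 j z.
Proof.
case: z => x y; rewrite derivable_section1 d1_section derive1E.
have -> : (fun t => trial i j (t, y)) = bump a r1 i * cst (bump 0 r2 j y) by [].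
have [h1 h2] := is_derive_bump a r10 i x.
have h3 : derivable (cst (bump 0 r2 j y)) x 1 by exact: derivable_cst.
split; first exact: (derivableM h1 h3).
by rewrite (deriveM h1 h3) derive_cst scaler0 add0r h2 /trial /= mulrC.
Qed.

Lemma derivable_trial2 i j z : derivable (trial i j) z (0, 1) /\
  d2 (trial i j) z = trial i j.+1 z.
Proof.
case: z => x y; rewrite derivable_section2 d2_section derive1E.
have -> : (fun t => trial i j (x, t)) = cst (bump a r1 i x) * bump 0 r2 j by [].
have [h1 h2] := is_derive_bump 0 r20 j y.
have h3 : derivable (cst (bump a r1 i x)) y 1 by exact: derivable_cst.
split; first exact: (derivableM h3 h1).
by rewrite (deriveM h3 h1) derive_cst scaler0 addr0 h2.
Qed.

Lemma d1_trial i j : d1 (trial i j) = trial i.+1 j.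
Proof. by apply/funext => z; case: (derivable_trial1 i j z). Qed.

Lemma d2_trial i j : d2 (trial i j) = trial i j.+1.
Proof. by apply/funext => z; case: (derivable_trial2 i j z). Qed.

Lemma Ck_trial k i j : Ck k (trial i j).
Proof.
have cont i' j' : continuous (trial i' j').
  move=> z; apply: cvgM.
    apply: (@continuous_comp _ _ _ fst (bump a r1 i')); first exact: cvg_fst.
    exact: bump_continuous.
  apply: (@continuous_comp _ _ _ snd (bump 0 r2 j')); first exact: cvg_snd.
  exact: bump_continuous.
elim: k i j => [|k IH] i j; first by split=> //; exact: cont.
split; first exact: cont.
split; [by move=> z; case: (derivable_trial1 i j z)|by move=> z; case: (derivable_trial2 i j z)| |].
- by rewrite d1_trial; exact: IH.
- by rewrite d2_trial; exact: IH.
Qed.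

Lemma trial_support i j z : trial i j z != 0 -> `|z.1 - a| < r1 /\ `|z.2| < r2.
Proof.
rewrite mulf_eq0 negb_or => /andP[/(bump_support r10) h1 /(bump_support r20)].
by rewrite subr0.
Qed.

Lemma trial_test (Omega : set plane) :
  (forall x y, `|x - a| <= r1 -> `|y| <= r2 -> Omega (x, y)) ->
  test_function Omega (trial 0 0).
Proof.
move=> KO; pose K : set plane := `[a - r1, a + r1] `*` `[- r2, r2].
have cK : compact K by apply: compact_setX; exact: segment_compact.
have sub : fsupport (trial 0 0) `<=` K.
  have /closure_id -> : closed K by exact: compact_closed.
  apply: closureS => z /trial_support[/ltW + /ltW +]; rewrite !ler_norml => /andP[h1 h2] h3.
  by split; rewrite /= in_itv//=; apply/andP; split; lra.
split; first by move=> k; exact: Ck_trial.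
  by apply: subclosed_compact cK sub; exact: closed_closure.
move=> [x y] /sub[/=]; rewrite !in_itv/= => /andP[h1 h2] h3; apply: KO.
  by rewrite ler_norml; apply/andP; split; lra.
by rewrite ler_norml.
Qed.

Variable Omega : set plane.
Hypothesis tt : test_function Omega (trial 0 0).

Local Notation A k := (\int[leb]_x (bump a r1 k x ^+ 2)%:E)%E.
Local Notation B k := (\int[leb]_y (bump 0 r2 k y ^+ 2)%:E)%E.

Lemma ip_trial i j : Lsq area (trial i j) ->
  (ip area (trial i j) (trial i j))%:E = (A i * B j)%E.
Proof.
move=> L; apply: (etrans (ip_EFin L)).
by apply: integral_product_sqr; exact: bump_continuous.
Qed.

Lemma trial_mass : (mass (jet (trial 0 0)) (jet (trial 0 0)))%:E = (A 0 * B 0)%E.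
Proof. by case: (jet_Lsq3 tt) => L _ _; exact: ip_trial. Qed.

Lemma trial_mass_gt0 : 0 < mass (jet (trial 0 0)) (jet (trial 0 0)).
Proof.
by rewrite -lte_fin trial_mass mule_gt0//; exact: bump_mass_gt0.
Qed.

Lemma trial_rayleigh : energy (jet (trial 0 0)) (jet (trial 0 0)) <=
  (3 / r1 ^+ 2 + 3 / r2 ^+ 2) * mass (jet (trial 0 0)) (jet (trial 0 0)).
Proof.
have [_ p2 p3] := jet_Lsq3 tt.
have {}p2 : Lsq area (trial 1 0) by rewrite -d1_trial; exact: p2.
have {}p3 : Lsq area (trial 0 1) by rewrite -d2_trial; exact: p3.
have sq0 (f : R -> R) : (0 <= \int[leb]_x (f x ^+ 2)%:E)%E.
  by apply: integral_ge0 => x _; rewrite lee_fin sqr_ge0.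
have -> : energy (jet (trial 0 0)) (jet (trial 0 0)) =
    ip area (trial 1 0) (trial 1 0) + ip area (trial 0 1) (trial 0 1).
  by rewrite -d1_trial -d2_trial.
have c0 (r : R) : (0 <= (3 / r ^+ 2)%:E)%E by rewrite lee_fin divr_ge0// sqr_ge0.
rewrite -lee_fin EFinM trial_mass EFinD (ip_trial p2) (ip_trial p3).
by apply: lee_rayleigh; rewrite ?sq0 ?divr_ge0 ?sqr_ge0//; exact: bump_rayleigh.
Qed.
End Trial.

(** * Counting eigenvalues of the broken guide *)
Section Counting.
Context {R : realType}.
Local Notation plane := (R * R)%type.
Local Notation leb := (@lebesgue_measure R).
Local Notation area := (leb \x leb)%E.
Local Notation V := ((plane -> R) * ((plane -> R) * (plane -> R)))%type.

(** The eigenvectors with a given eigenvalue [l] bound its multiplicity from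
    below by their number [m l], and these numbers add up to [n]. *)
Lemma eigenvalue_count_ge (Omega : set plane) n (psi : nat -> V) (lam : nat -> R) (b : R) :
  measurable Omega ->
  (forall i, (i < n)%N -> [/\ form_space Omega (psi i), lam i < b &
      forall W, form_space Omega W -> energy (psi i) W = lam i * mass (psi i) W]) ->
  (forall i j, (i < n)%N -> (j < n)%N -> mass (psi i) (psi j) = (i == j)%:R) ->
  (n%:R%:E <= eigenvalue_count Omega (dirichlet_laplacian Omega) b)%E.
Proof.
move=> mO eig orth.
pose m l := #|[pred i : 'I_n | lam i == l]|.
have mult l : ((m l)%:R%:E <= multiplicity Omega (dirichlet_laplacian Omega) l)%E.
  apply: ereal_sup_ubound; exists (m l) => //.
  pose e (k : 'I_(m l)) : 'I_n := enum_val k.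
  have le k : lam (e k) = l by apply/eqP; have := enum_valP k.
  exists (fun k => (psi (e k)).1); split=> [k|].
    have [Hk _ ek] := eig _ (ltn_ord (e k)).
    by apply: form_space_eigen => // W HW; rewrite ek// le.
  apply: (form_space_lin_indep (psi := fun k => psi (e k))).
    by move=> k; case: (eig _ (ltn_ord (e k))).
  by move=> k k'; rewrite orth// (inj_eq val_inj) (inj_eq enum_val_inj).
pose s := undup [seq lam i | i : 'I_n <- enum 'I_n].
apply: esum_ge; exists [set` s].
  split; first exact: finite_seq.
  move=> l; rewrite /= mem_undup => /mapP[i _ ->].
  by case: (eig _ (ltn_ord i)).
rewrite -fsbig_seq ?undup_uniq//.
apply: (@le_trans _ _ (\sum_(l <- s) (m l)%:R%:E)%E); last by apply: lee_sum => l _; exact: mult.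
rewrite sumEFin lee_fin -natr_sum ler_nat.
rewrite [leqRHS](_ : _ = \sum_(l <- s) \sum_(i < n) (lam i == l))%N; last first.
  by apply: eq_bigr => l _; rewrite /m -sum1_card big_mkcond.
rewrite exchange_big/= -[leqLHS]card_ord -sum1_card; apply: leq_sum => i _.
rewrite (bigD1_seq (lam i)) ?undup_uniq ?eqxx//=.
by rewrite mem_undup; apply/mapP; exists i => //; rewrite mem_enum.
Qed.

Lemma ip_disjoint (f g : plane -> R) : (forall z, f z * g z = 0) -> ip area f g = 0.
Proof.
move=> fg; rewrite /ip /Rintegral; under eq_integral do rewrite fg.
by rewrite integral0.
Qed.

Lemma sin_le_id (x : R) : 0 <= x -> sin x <= x.
Proof.
move=> x0; have [|c _] := @MVT_segment R sin cos 0 x x0.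
  by apply: continuous_subspaceT => t; exact: continuous_sin.
by rewrite sin0 !subr0 => ->; rewrite ler_piMl// cos_le1.
Qed.

Lemma guide_measurable (theta : R) : measurable (broken_guide theta).
Proof.
have m1 : measurable_fun setT (fun z : plane => z.1) by exact: measurable_fst.
have m2 : measurable_fun setT (fun z : plane => `|z.2|).
  by apply: measurableT_comp => //; exact: measurable_snd.
rewrite (_ : broken_guide theta =
  [set z : plane | z.1 * tan theta < `|z.2|] `&`
  [set z : plane | `|z.2| < (z.1 + pi / sin theta) * tan theta]); last first.
  by apply/seteqP; split => z /=; [move/andP|move=> [? ?]; apply/andP].
have lt (f g : plane -> R) : measurable_fun setT f -> measurable_fun setT g ->
    measurable [set z | f z < g z].
  move=> mf mg; rewrite (_ : [set z | f z < g z] = ~` (setT `&` [set z | g z <= f z])).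
    by apply: measurableC; exact: measurable_fun_le.
  by rewrite setTI; apply/seteqP; split => z /=; rewrite ltNge => /negP.
apply: measurableI; apply: lt => //; first exact: measurable_funM.
by apply: measurable_funM => //; exact: measurable_funD.
Qed.

(** The bump number [i] is centred at [(a i, 0)] with [a i = - (2 * i + 2) * rho1],
    so that consecutive supports only touch. All of them lie between
    [- (2 * n + 1) * rho1] and [- rho1] in the first coordinate, and the
    assumption says that the guide is still high enough at the left end. *)
Lemma many_trials (theta rho1 rho2 : R) n : 0 < theta < pi / 2 -> 0 < rho1 -> 0 < rho2 ->
  rho2 + (2 * n + 1)%:R * rho1 * tan theta < pi ->
  exists v : 'I_n -> V, [/\ forall i, form_space (broken_guide theta) (v i),
    forall i j, i != j -> mass (v i) (v j) = 0,
    forall i j, i != j -> energy (v i) (v j) = 0,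
    forall i, 0 < mass (v i) (v i) &
    forall i, energy (v i) (v i) <= (3 / rho1 ^+ 2 + 3 / rho2 ^+ 2) * mass (v i) (v i)].
Proof.
move=> th r10 r20 fit; have /andP[th0 th1] := th.
have c0 : 0 < cos theta by exact: cos_acute_gt0.
have s0 : 0 < sin theta by exact: sin_gt0_pihalf.
have t0 : 0 < tan theta by exact: divr_gt0.
have natE k l : (2 * k + l)%:R = 2 * k%:R + l%:R :> R by rewrite natrD natrM.
pose a (i : 'I_n) : R := - (2 * i + 2)%:R * rho1.
pose T i := trial (a i) rho1 rho2.
have tT i : test_function (broken_guide theta) (T i 0 0)%N.
  apply: trial_test => // x y xa yr.
  have [x1 x2] : - (2 * n + 1)%:R * rho1 <= x /\ x < 0.
    have i1 : (2 * i + 3)%:R <= (2 * n + 1)%:R :> R.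
      by rewrite ler_nat; move: (ltn_ord i); clear; lia.
    move: xa; rewrite ler_norml /a => /andP[h1 h2].
    have := ler_wpM2r (ltW r10) i1; have : (0 : R) <= i%:R by [].
    rewrite ?natE in h1 h2 *.
    have : 0 <= i%:R * rho1 by rewrite mulr_ge0// ltW.
    by move=> *; split; lra.
  rewrite /broken_guide /=; apply/andP; split.
    by apply: lt_le_trans (normr_ge0 y); rewrite pmulr_llt0.
  have -> : (x + pi / sin theta) * tan theta = x * tan theta + pi / cos theta.
    by rewrite /tan; field; rewrite !gt_eqF.
  have h1 : pi <= pi / cos theta by rewrite ler_pdivlMr// ler_piMr ?pi_ge0// cos_le1.
  have h2 := ler_wpM2r (ltW t0) x1.
  by apply: le_lt_trans yr _; move: h1 h2 fit; lra.
have disj i j k l k' l' z : i != j -> T i k l z * T j k' l' z = 0.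
  move=> ij; apply/eqP; rewrite mulf_eq0; apply/negPn/negP.
  rewrite negb_or => /andP[/(trial_support r10 r20)[h1 _] /(trial_support r10 r20)[h2 _]].
  move: h1 h2; rewrite /a !ltr_norml => /andP[i1 i2] /andP[j1 j2].
  rewrite ?natE in i1 i2 j1 j2.
  move: ij; rewrite -val_eqE neq_ltn => /orP[] h.
    have : (i%:R + 1) * rho1 <= j%:R * rho1 by rewrite ler_pM2r// natr1 ler_nat.
    lra.
  have : (j%:R + 1) * rho1 <= i%:R * rho1 by rewrite ler_pM2r// natr1 ler_nat.
  lra.
exists (fun i => jet (T i 0 0)%N); split.
- by move=> i; exact: form_space_jet.
- by move=> i j ij; apply: ip_disjoint => z; exact: disj.
- move=> i j ij; rewrite /energy /= !d1_trial// !d2_trial//.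
  by rewrite !ip_disjoint ?addr0// => z; exact: disj.
- by move=> i; exact: trial_mass_gt0 (tT i).
- by move=> i; exact: trial_rayleigh (tT i).
Qed.
End Counting.

Section Main.
Context {R : realType}.
Local Notation plane := (R * R)%type.
Local Notation V := ((plane -> R) * ((plane -> R) * (plane -> R)))%type.

Lemma guide_eigenvalue_count (theta lam0 : R) n (v : 'I_n -> V) :
  0 < theta < pi / 2 ->
  (forall i, form_space (broken_guide theta) (v i)) ->
  (forall i j, i != j -> mass (v i) (v j) = 0) ->
  (forall i j, i != j -> energy (v i) (v j) = 0) ->
  (forall i, 0 < mass (v i) (v i)) ->
  (forall i, energy (v i) (v i) <= lam0 * mass (v i) (v i)) ->
  lam0 < 1 -> lam0 * ((pi / cos theta) ^+ 2 / 4) < 1 ->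
  (n%:R%:E <= eigenvalue_count (broken_guide theta)
     (dirichlet_laplacian (broken_guide theta)) 1)%E.
Proof.
move=> th Hv mv ev mv0 evl lam1 lamk; have /andP[th0 th1] := th.
have c0 : 0 < cos theta by exact: cos_acute_gt0.
have s0 : 0 < sin theta by exact: sin_gt0_pihalf.
pose L : R := pi / cos theta.
have L1 : 1 <= L.
  rewrite ler_pdivlMr// mul1r; apply: le_trans (cos_le1 theta) _.
  by apply: le_trans (pi_ge2 R); rewrite ler1n.
have L0 : 0 < L by exact: lt_le_trans L1.
(* Enough squares of side [1 / 2] to cover the part of the guide on the left. *)
pose N := (Num.truncn (2 * (pi / sin theta + L))).+1.
have N12 : 2 * (pi / sin theta + L) < N%:R by exact: truncnS_gt.
have ps : 0 < pi / sin theta by rewrite divr_gt0// pi_gt0.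
have N1 : pi / sin theta < N%:R * 2^-1 by lra.
have N2 : L < N%:R * 2^-1 by lra.
have sub : form_space (broken_guide theta) `<=` @Lsq3 R by move=> U [].
have kap0 : 0 < L ^+ 2 / 4 by rewrite divr_gt0// exprn_gt0.
have [psi [lam [eig orth]]] := @weak_eigenvectors R V (form_space (broken_guide theta))
  mass energy (form_space_subspace _) (form_on_sub sub mass_form)
  (form_on_sub sub energy_form) (fun w _ => mass_ge0 w) (fun w _ => energy_ge0 w)
  (@form_space_complete R _) _ (ell N) (L ^+ 2 / 4) 4 _
  (fun k U W HU HW => ellB k HU.1 HW.1) (fun k U HU => ell_bounded k HU.1)
  kap0 (ler0n R 4) (fun U HU => coercive_form_space th N1 N2 L1 HU)
  n v lam0 Hv mv ev mv0 evl lamk.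
apply: (eigenvalue_count_ge (guide_measurable theta) _ orth) => i hi.
have [Hi li ei] := eig i hi; split; [exact: Hi|exact: le_lt_trans li lam1|exact: ei].
Qed.
End Main.

Theorem mainTheorem4 (R : realType) :
  exists c theta0 : R,
    [/\ 0 < c, 0 < theta0 < pi / 2 &
      forall theta : R, 0 < theta < theta0 ->
        ((c * theta^-1)%:E <=
          eigenvalue_count (broken_guide theta)
            (dirichlet_laplacian (broken_guide theta)) 1)%E].
Proof.
have pi2 := pi_ge2 R.
have pi0 : 0 < pi :> R by exact: pi_gt0.
have [a a0 a1] : exists2 a : R, 0 < a & 1000 * a = 1.
  have h : 0 < 1000 :> R by rewrite ltr0n.
  by exists 1000^-1; [rewrite invr_gt0 ltr0n|exact: (mulfV (lt0r_neq0 h))].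
exists a, a; split=> //; first by apply/andP; split; lra.
move=> theta /andP[th0 th1].
have th : 0 < theta < pi / 2 by apply/andP; split; lra.
have c0 : 0 < cos theta by exact: cos_acute_gt0.
have s0 : 0 < sin theta by exact: sin_gt0_pihalf.
have sth : sin theta <= theta by exact/sin_le_id/ltW.
have c99 : 99 / 100 <= cos theta ^+ 2.
  rewrite cos2sin2; have : sin theta ^+ 2 <= 100^-1; last by lra.
  rewrite expr2; apply: le_trans (ler_pM (ltW s0) (ltW s0) sth sth) _.
  apply: (@le_trans _ _ (1 * theta)); last by lra.
  by rewrite ler_wpM2r ?(ltW th0)//; lra.
have c12 : 1 / 2 <= cos theta.
  apply: (@le_trans _ _ (cos theta ^+ 2)); first by lra.
  by rewrite expr2; exact: (ler_piMl (ltW c0) (cos_le1 theta)).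
have tan2 : tan theta <= 2 * theta.
  rewrite ler_pdivrMr//; apply: (le_trans sth).
  by rewrite -[leLHS]mul1r mulrAC ler_wpM2r ?(ltW th0)//; lra.
(* As [a = 1 / 1000], the [n] bumps, each of width [20 * pi], occupy a length of
   order [pi / (50 * theta)]; the guide loses less than [pi / 10] of its
   half-height over it. *)
pose x := a / theta; pose n := (Num.truncn x).+1.
have xt : x * theta = a by rewrite /x divfK// gt_eqF.
have x0 : 0 <= x by rewrite divr_ge0 ?ltW.
have xn : x < n%:R by exact: truncnS_gt.
have nx : n%:R <= x + 1 by rewrite -natr1 lerD2r; case/andP: (truncn_itv x0).
pose rho1 : R := 10 * pi; pose rho2 : R := 9 / 10 * pi.
have r10 : 0 < rho1 by rewrite mulr_gt0.
have r20 : 0 < rho2 by rewrite mulr_gt0// divr_gt0.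
have fit : rho2 + (2 * n + 1)%:R * rho1 * tan theta < pi.
  have h1 : (2 * n + 1)%:R * tan theta <= (2 * x + 3) * (2 * theta).
    apply: ler_pM => //; first by rewrite divr_ge0 ?ltW.
    by rewrite natrD natrM; lra.
  have h2 : (2 * x + 3) * (2 * theta) < 100^-1.
    have -> : (2 * x + 3) * (2 * theta) = 4 * (x * theta) + 6 * theta by ring.
    by rewrite xt; lra.
  have h3 : (2 * n + 1)%:R * tan theta * pi < 100^-1 * pi.
    by rewrite ltr_pM2r//; exact: le_lt_trans h1 h2.
  have -> : (2 * n + 1)%:R * rho1 * tan theta = 10 * ((2 * n + 1)%:R * tan theta * pi).
    by rewrite /rho1; ring.
  by rewrite /rho2; move: h3; move: (_ * _ * pi) => y; lra.
have [v [Hv mv ev mv0 evl]] := many_trials th r10 r20 fit.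
(* The value [K < 3.74] has to stay below [4 * cos theta ^+ 2], which is at least
   [3.96]. *)
pose K : R := 3 / 100 + 300 / 81.
have pin : pi != 0 :> R by rewrite gt_eqF.
have lamE : 3 / rho1 ^+ 2 + 3 / rho2 ^+ 2 = K / pi ^+ 2.
  by rewrite /rho1 /rho2 /K; move: (pi : R) pin => p p0; field.
have K4 : K < 374 / 100 by rewrite /K; lra.
have pi4 : 4 <= pi ^+ 2 :> R by rewrite expr2; nra.
have pis : 0 < pi ^+ 2 :> R by rewrite exprn_gt0.
apply: (@le_trans _ _ n%:R%:E); first by rewrite lee_fin ltW.
apply: (guide_eigenvalue_count th Hv mv ev mv0 evl); rewrite lamE.
  by rewrite ltr_pdivrMr// mul1r; lra.
have cn : cos theta != 0 by rewrite gt_eqF.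
have -> : K / pi ^+ 2 * ((pi / cos theta) ^+ 2 / 4) = K / (4 * cos theta ^+ 2).
  by move: (pi : R) (cos theta) pin cn => p q p0 q0; field; rewrite p0 q0.
by rewrite ltr_pdivrMr; [lra|rewrite mulr_gt0// exprn_gt0].
Qed.
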